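(* Let $T>0$, $b\in C_b^1(\mathbb{R})$ and, for $x\in\mathbb{R}$, let $(X_t(x))_{t\ge0}$ be the solution of $dX_t(x)=dW_t+b(X_t(x))\,dt$, $X_0(x)=x$. Let $p\ge1$ and let $M>0$ be the constant described in the context. Then for every $t\in[0,T]$ and $x\in\mathbb{R}$, $$\mathbb{E}\bigl(|X_t'(x)|^p\bigr)\le\bigl(1+2pM\sqrt{t}\,\|b\|_\infty\bigr)\exp\Bigl((1+2p^2M^2)\,T\,\|b\|_\infty^2\Bigr),$$ where $X_t'(x)$ denotes the derivative of $x\mapsto X_t(x)$.
   Context: $(W_t)_{t\ge0}$ is a one-dimensional standard Brownian motion started at $0$. $C_b^1(\mathbb{R})$ is the space of bounded $C^1$ functions with bounded derivative. For such $b$ the map $x\mapsto X_t(x)$ is differentiable and $X_t'(x)=\exp\bigl(\int_0^t b'(X_s(x))\,ds\bigr)$. The constant $M$: it is a known result of Davie that there is a constant $M>0$ such that for every $b\in C_b^1(\mathbb{R})$, every $n\in\mathbb{N}$ and every $t>0$, $$|I_n(t)|\le\frac{M^n}{[n/2]!}\,\|b\|_\infty^n\,t^{n/2},\qquad I_n(t)=\int_{0<s_1<\cdots<s_n<t}\mathbb{E}\bigl(b'(W_{s_1})\cdots b'(W_{s_n})\bigr)\,ds_1\cdots ds_n,$$ where $[\cdot]$ denotes the integer part. $M$ is any constant for which this estimate holds. *)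

(* Defs.v *)
From HB Require Import structures.
From mathcomp Require Import all_boot all_order all_algebra.
From mathcomp Require Import all_classical all_reals all_analysis.

Set Implicit Arguments.
Unset Strict Implicit.
Unset Printing Implicit Defensive.

Import Order.TTheory GRing.Theory Num.Theory.
Import numFieldNormedType.Exports.

Local Open Scope classical_set_scope.
Local Open Scope ring_scope.

Definition Cb1 (R : realType) (b : R -> R) : Prop :=
  [/\ bounded_fun b,
      forall x, derivable b x 1,
      continuous (derive1 b) &
      bounded_fun (derive1 b)].

Definition sup_norm (R : realType) (b : R -> R) : R :=
  sup (range (fun x => `|b x|)).

Section Probability.
Context {d : measure_display} {Omega : measurableType d} {R : realType}.
Variable P : probability Omega R.

Definition mutually_independent (I : finType) (Y : I -> Omega -> R) : Prop :=
  forall (J : {set I}) (A : I -> set R),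
    (forall i, measurable (A i)) ->
    P (\bigcap_(i in [set i | i \in J]) (Y i @^-1` A i)) =
    (\prod_(i in J) P (Y i @^-1` A i))%E.

(* The time index ranges over R, but only the times t >= 0 are constrained.
   The second parameter of normal_prob is the standard deviation; the strict
   inequality s < t is needed because normal_prob m 0 is not a Dirac mass. *)
Record standard_brownian_motion (W : R -> {RV P >-> R}) : Prop := {
  bm_start : {ae P, forall w, W 0 w = 0} ;
  bm_gaussian : forall s t, 0 <= s -> s < t ->
    forall A, measurable A ->
      P ((W t \- W s) @^-1` A) = normal_prob 0 (Num.sqrt (t - s)) A ;
  bm_indep : forall (n : nat) (t : nat -> R),
    0 <= t 0 -> (forall i, t i < t i.+1) ->
    mutually_independent (fun (i : 'I_n) w => W (t i.+1) w - W (t i) w) ;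
  bm_continuous : {ae P, forall w,
    {within `[0, +oo[, continuous (fun t => W t w)}} }.

(* Since the noise is additive, the equation is understood path by path, with
   an exceptional null set that does not depend on the starting point x, so
   that x |-> X t x w can be differentiated for almost every w. *)
Definition sde_flow (b : R -> R) (W : R -> {RV P >-> R})
    (X : R -> R -> {RV P >-> R}) : Prop :=
  {ae P, forall w, forall x : R,
    {within `[0, +oo[, continuous (fun t => X t x w)} /\
    forall t, 0 <= t ->
      X t x w =
      x + W t w + \int[lebesgue_measure]_(s in `[0, t]) b (X s x w)}.

(* Integral of f [:: s_1; ...; s_n] over 0 < s_1 < ... < s_n < t, written as an
   iterated integral whose outermost variable is s_n. *)
Fixpoint simplex_integral (n : nat) (t : R) (f : seq R -> R) : R :=
  if n is m.+1 then
    \int[lebesgue_measure]_(s in `]0, t[)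
      simplex_integral m s (fun l => f (rcons l s))
  else f [::].

Definition davie_integral (W : R -> {RV P >-> R}) (b : R -> R) (n : nat)
    (t : R) : R :=
  simplex_integral n t
    (fun l => fine ('E_P[fun w => (\prod_(s <- l) derive1 b (W s w))%R])%E).

Definition davie_constant (W : R -> {RV P >-> R}) (M : R) : Prop :=
  0 < M /\
  forall b : R -> R, Cb1 b -> forall (n : nat) (t : R), 0 < t ->
    `|davie_integral W b n t| <=
    M ^+ n / (n./2)`!%:R * sup_norm b ^+ n * t `^ (n%:R / 2).

End Probability.

(* Main.v *)
Require Import Defs.
From HB Require Import structures.
From mathcomp Require Import all_boot all_order all_algebra.
From mathcomp Require Import all_classical all_reals all_analysis.
From mathcomp Require Import measurable_realfun ring lra.

Set Implicit Arguments.
Unset Strict Implicit.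
Unset Printing Implicit Defensive.

Import Order.TTheory GRing.Theory Num.Theory.
Import numFieldNormedType.Exports.

Local Open Scope classical_set_scope.
Local Open Scope ring_scope.

(** The estimate is a change of measure followed by the Cauchy-Schwarz
inequality. The derivative of the flow is exp(int_0^t b'(X_s) ds), so its p-th
power has expectation E exp(p int_0^t b'(X_s) ds). Girsanov's theorem turns
X(x) into x + W at the price of a density D, and
  E[exp(p int b'(x + W)) D]^2 <= E[exp(2 p int b'(x + W))] E[D^2],
where E[D^2] <= exp(t |b|^2). Expanding the remaining exponential gives the
series of (2 p)^n I_n(t) for the translate b(x + .), and Davie's bound sums it
to at most (1 + a) exp(a^2) with a = 2 p M sqrt(t) |b|.

No stochastic integral enters, because the change of measure is carried out on
the Euler scheme. There the density is a product of Gaussian translation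
factors, one for each increment, and both Girsanov and Cauchy-Schwarz reduce to
one inequality on Gaussian averages,
  (E u(y + m + xi))^2 <= exp(m^2 / s^2) E u(y + xi)^2,   xi ~ N(0, s^2)
([gauss_mean_cauchy_schwarz]). Iterated along the Markov chain with
m = b(x) h and s^2 = h, it compares the scheme with drift b to the one without
drift and costs the factor exp(h |b|^2) at each step, hence exp(t |b|^2) in all
([euler_value_girsanov], [discrete_girsanov]). The link between the iterated
averages and the Brownian motion is the independence of its increments
([freezing], [euler_expectation]).

Everything else is pathwise. The Euler scheme converges to the solution for
every continuous path of the noise ([euler_sum_cvg]), so bounded convergence
carries the comparison to the limit ([girsanov_estimate]). The formula for the
derivative of the flow follows from Gronwall's inequality, as the noise cancels
in the difference of two solutions ([flow_derivative]). The iterated integrals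
I_n are identified with the moments of int_0^t b'(x + W_s) ds divided by n! by
induction on n, each step being the fundamental theorem of calculus under the
expectation ([simplex_integral_power]); the resulting series is bounded in
[exponential_moment_le]. *)

(** * Uniform continuity, primitives and Riemann sums *)
Section calculus.
Context {R : realType}.
Local Notation mu := (@lebesgue_measure R).

(** Heine's theorem, from the covering form of compactness: near each x a
radius of continuity serves all points close to x. Only u has to lie in the
segment. *)
Lemma uniform_continuity_segment (f : R -> R) (a b : R) : continuous f ->
  forall e, 0 < e -> exists2 d, 0 < d &
    forall u v, u \in `[a, b] -> `|u - v| < d -> `|f u - f v| < e.
Proof.
move=> cf e e0.
have := @segment_compact R a b; rewrite compact_near_coveringP => cover.
pose Q (d u : R) := forall v, `|u - v| < d -> `|f u - f v| < e.
have : \forall d \near 0^'+, `[a, b] `<=` Q d.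
  apply: cover => x _.
  have e20 : 0 < e / 2 by rewrite divr_gt0.
  have /cvgrPdist_lt/(_ _ e20)/nbhs_ballP[r r0 xr] := cf x.
  exists (ball x (r / 2), [set d | 0 < d < r / 2]) => /=.
    split.
      by apply: nbhsx_ballx; rewrite divr_gt0.
    near=> d; apply/andP; split => //.
    by near: d; apply: nbhs_right_lt; rewrite divr_gt0.
  move=> [u d] /= [xu /andP[d0 dr]] v uv.
  have fu : `|f x - f u| < e / 2.
    apply: xr; rewrite /ball/=; apply: lt_trans xu _.
    by rewrite ltr_pdivrMr// ltr_pMr// ltr1n.
  have fv : `|f x - f v| < e / 2.
    apply: xr; rewrite /ball/= -(subrKA u) (le_lt_trans (ler_normD _ _))//.
    by rewrite [ltRHS]splitr ltrD// (lt_trans uv).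
  rewrite -(subrKA (f x)) (le_lt_trans (ler_normD _ _))// [ltRHS]splitr.
  by rewrite ltrD// distrC.
move=> [d /= d0 dQ]; exists (d / 2); first by rewrite divr_gt0.
move=> u v uab uv; apply: (dQ (d / 2)) => //=.
- by rewrite sub0r normrN gtr0_norm ?divr_gt0// ltr_pdivrMr// ltr_pMr// ltr1n.
- by rewrite divr_gt0.
Unshelve. all: by end_near. Qed.

Lemma continuous_integrable_segment (f : R -> R) (a b : R) : continuous f ->
  mu.-integrable `[a, b] (EFin \o f).
Proof.
move=> cf; apply: continuous_compact_integrable.
  exact: segment_compact.
exact: continuous_subspaceT.
Qed.

Definition primitive (f : R -> R) (t : R) : R := \int[mu]_(s in `[0, t]) f s.

Lemma primitive0 (f : R -> R) : primitive f 0 = 0.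
Proof. by rewrite /primitive set_itv1 Rintegral_set1. Qed.

Lemma is_derive_primitive (f : R -> R) (t : R) : continuous f -> 0 < t ->
  is_derive t 1 (primitive f) (f t).
Proof.
move=> cf t0; have tt : t < t + 1 by rewrite ltrDl.
have [d1 d2] := @continuous_FTC1_closed R f 0 t (t + 1) tt
  (continuous_integrable_segment 0 (t + 1) cf) t0 (cf t).
apply: DeriveDef; first exact: d1.
by rewrite -derive1E; exact: d2.
Qed.

Lemma continuous_primitive (f : R -> R) (t : R) : continuous f ->
  {within `[0, t], continuous (primitive f)}.
Proof.
move=> cf; have [t0|t0] := leP 0 t.
  exact/parameterized_integral_continuous/continuous_integrable_segment.
rewrite set_itv_ge; first exact: continuous_subspace0.
by rewrite -leNgt ltW.
Qed.

Lemma within_segmentS (f : R -> R) (a b c d : R) : a <= c -> d <= b ->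
  {within `[a, b], continuous f} -> {within `[c, d], continuous f}.
Proof.
by move=> ac db; apply: continuous_subspaceW; apply: subset_itv;
  rewrite bnd_simp.
Qed.

Lemma is_derive_mul (f g : R -> R) (x df dg : R) :
  is_derive x 1 f df -> is_derive x 1 g dg ->
  is_derive x 1 (fun s => f s * g s) (f x * dg + g x * df).
Proof. exact: is_deriveM. Qed.

Lemma is_derive_sub (f g : R -> R) (x df dg : R) :
  is_derive x 1 f df -> is_derive x 1 g dg ->
  is_derive x 1 (fun s => f s - g s) (df - dg).
Proof. exact: is_deriveB. Qed.

Lemma is_derive_linear (a x : R) : is_derive x 1 (fun s => a * s) a.
Proof.
apply: is_derive_eq (is_derive_mul (is_derive_cst a x 1) (is_derive_id x 1)) _.
by rewrite mulr1 mulr0 addr0.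
Qed.

Lemma is_derive_exp (f : R -> R) (x df : R) : is_derive x 1 f df ->
  is_derive x 1 (fun s => expR (f s)) (df * expR (f x)).
Proof.
move=> fd; rewrite mulrC.
exact: (@is_derive1_comp R expR f x (expR (f x)) df).
Qed.

Lemma is_derive_pow (f : R -> R) (x df : R) n : is_derive x 1 f df ->
  is_derive x 1 (fun s => f s ^+ n.+1) (n.+1%:R * f x ^+ n * df).
Proof.
move=> fd; elim: n => [|n IH]; first by rewrite expr0 !mul1r; exact: fd.
apply: is_derive_eq (is_derive_mul fd IH) _.
by rewrite exprS -[n.+2%:R]natr1; ring.
Qed.

(** The interval is cut into n.+1 cells, so that the step makes sense for every
natural number n. *)
Definition mesh (t : R) (n : nat) : R := t / n.+1%:R.

Lemma mesh_ge0 (t : R) n : 0 <= t -> 0 <= mesh t n.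
Proof. by move=> t0; rewrite divr_ge0. Qed.

Lemma mesh_gt0 (t : R) n : 0 < t -> 0 < mesh t n.
Proof. by move=> t0; rewrite divr_gt0. Qed.

Lemma mesh_total (t : R) n : n.+1%:R * mesh t n = t.
Proof. by rewrite /mesh mulrC divfK// pnatr_eq0. Qed.

Lemma mesh_cvg0 (t : R) : mesh t n @[n --> \oo] --> 0.
Proof.
by rewrite -(mulr0 t); apply: cvgM; [exact: cvg_cst|exact: cvg_harmonic].
Qed.

Lemma mesh_pt_ge0 (t : R) n k : 0 <= t -> 0 <= k%:R * mesh t n.
Proof. by move=> t0; rewrite mulr_ge0// mesh_ge0. Qed.

Lemma mesh_pt_le (t : R) n k : 0 <= t -> (k <= n.+1)%N -> k%:R * mesh t n <= t.
Proof.
move=> t0 kn; rewrite -[leRHS](mesh_total t n) ler_wpM2r ?mesh_ge0//.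
by rewrite ler_nat.
Qed.

Lemma mesh_step (t : R) n (k : nat) :
  k.+1%:R * mesh t n = k%:R * mesh t n + mesh t n.
Proof. by rewrite -natr1 mulrDl mul1r. Qed.

(** On one cell an increment of a primitive is a value of its derivative times
the step. This single fact drives both the convergence of Riemann sums and the
error analysis of the Euler scheme. *)
Lemma mesh_mean_value (t : R) n k (G H : R -> R) : 0 <= t -> (k < n.+1)%N ->
  {within `[0, t], continuous G} ->
  (forall s : R, 0 < s -> is_derive s 1 G (H s)) ->
  exists2 c, c \in `[k%:R * mesh t n, k%:R * mesh t n + mesh t n] &
    G (k.+1%:R * mesh t n) - G (k%:R * mesh t n) = H c * mesh t n.
Proof.
move=> t0 kn cG dG.
have kk : k%:R * mesh t n <= k.+1%:R * mesh t n.
  by rewrite ler_wpM2r ?mesh_ge0// ler_nat.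
have := @MVT_segment R G H _ _ kk.
rewrite -mulrBl mesh_step -natr1 addrAC subrr add0r mul1r.
apply.
- move=> x; rewrite in_itv/= => /andP[kx _]; apply: dG.
  by apply: le_lt_trans kx; rewrite mesh_pt_ge0.
- apply: within_segmentS cG; first exact: mesh_pt_ge0.
  by rewrite -mesh_step mesh_pt_le.
Qed.

Definition riemann_sum (H : R -> R) (t : R) (n : nat) : R :=
  \sum_(k < n.+1) H (k%:R * mesh t n) * mesh t n.

(** The increment of G over the interval telescopes over the cells, and on each
cell it is H at an intermediate point, which uniform continuity replaces by the
left end point. Having a general G with derivative H, rather than an integral,
makes the lemma apply to powers of an integral as well. *)
Lemma riemann_sum_cvg (H G : R -> R) (t : R) : 0 <= t -> continuous H ->
  {within `[0, t], continuous G} ->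
  (forall s : R, 0 < s -> is_derive s 1 G (H s)) ->
  riemann_sum H t n @[n --> \oo] --> G t - G 0.
Proof.
move=> t0 cH cG dG; apply/cvgrPdist_le => e e0.
have et0 : 0 < e / (t + 1) by rewrite divr_gt0// ltr_wpDl.
have [d d0 Hd] := @uniform_continuity_segment H 0 t cH _ et0.
have /cvgrPdist_lt/(_ _ d0) := mesh_cvg0 t.
apply: filterS => n; rewrite sub0r normrN ger0_norm ?mesh_ge0// => nd.
have -> : G t - G 0 = \sum_(k < n.+1)
    (G (k.+1%:R * mesh t n) - G (k%:R * mesh t n)).
  rewrite -(big_mkord xpredT (fun k => G (k.+1%:R * mesh t n) - G (k%:R * mesh t n))).
  by rewrite telescope_sumr// mul0r mesh_total.
rewrite /riemann_sum -sumrB (le_trans (ler_norm_sum _ _ _))//.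
rewrite (@le_trans _ _ (\sum_(k < n.+1) e / (t + 1) * mesh t n))//; last first.
  rewrite sumr_const card_ord -mulr_natl mulrCA mesh_total.
  rewrite mulrAC ler_pdivrMr; last by rewrite ltr_wpDl.
  by apply: ler_wpM2l; [exact: ltW|rewrite lerDl].
apply: ler_sum => k _.
have [c cin ->] := mesh_mean_value t0 (ltn_ord k) cG dG.
rewrite -mulrBl normrM (ger0_norm (mesh_ge0 _ _))// ler_wpM2r ?mesh_ge0//.
move: cin; rewrite in_itv/= => /andP[c1 c2].
apply/ltW/Hd.
  rewrite in_itv/= (le_trans _ c1) ?mesh_pt_ge0//=.
  by rewrite (le_trans c2)// -mesh_step mesh_pt_le.
by rewrite ger0_norm ?subr_ge0// (le_lt_trans _ nd)// lerBlDl.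
Qed.

Lemma riemann_sum_primitive (H : R -> R) (t : R) : 0 <= t -> continuous H ->
  riemann_sum H t n @[n --> \oo] --> primitive H t.
Proof.
move=> t0 cH; rewrite -[primitive H t]subr0 -(primitive0 H).
apply: riemann_sum_cvg => //; first exact: continuous_primitive.
by move=> s s0; exact: is_derive_primitive.
Qed.

End calculus.

(** * The flow and the Euler scheme along one path of the noise *)
Section pathwise.
Context {R : realType}.
Variables (b db : R -> R) (K : R).
Hypothesis b_derive : forall x : R, is_derive x 1 b (db x).
Hypothesis db_cont : continuous db.
Hypothesis db_le : forall x, `|db x| <= K.

Lemma drift_continuous : continuous b.
Proof.
move=> x; apply: differentiable_continuous.
by apply/derivable1_diffP; have [] := b_derive x.
Qed.

(** The intermediate point is located by its distance to u, which needs no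
ordering of u and v. *)
Lemma drift_mean_value (u v : R) :
  exists2 c, `|u - c| <= `|u - v| & b v - b u = db c * (v - u).
Proof.
have cts c d : {within `[c, d], continuous b}.
  exact/continuous_subspaceT/drift_continuous.
have [uv|/ltW vu] := leP u v.
- have [c] := @MVT_segment _ b db u v uv (fun x _ => b_derive x) (cts _ _).
  rewrite in_itv/= => /andP[uc cv] E; exists c => //.
  by rewrite distrC (distrC u) !ger0_norm ?subr_ge0// lerD2r.
- have [c] := @MVT_segment _ b db v u vu (fun x _ => b_derive x) (cts _ _).
  rewrite in_itv/= => /andP[uc cv] E; exists c => //.
    by rewrite !ger0_norm ?subr_ge0// lerD2l lerN2.
  by rewrite -opprB E -mulrN opprB.
Qed.

Lemma drift_lipschitz (u v : R) : `|b v - b u| <= K * `|v - u|.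
Proof.
by have [c _ ->] := drift_mean_value u v; rewrite normrM ler_wpM2r.
Qed.

Let K_ge0 : 0 <= K. Proof. exact: le_trans (db_le 0). Qed.

Lemma primitive_mean_value (f : R -> R) (t : R) : continuous f -> 0 <= t ->
  exists2 c, c \in `[0, t] & primitive f t = f c * t.
Proof.
move=> cf t0.
have df (s : R) : s \in `]0, t[ -> is_derive s 1 (primitive f) (f s).
  by rewrite in_itv/= => /andP[s0 _]; exact: is_derive_primitive.
have [c c0t] := MVT_segment t0 df (continuous_primitive (t := t) cf).
by rewrite primitive0 !subr0 => ->; exists c.
Qed.

Lemma primitive_norm_le (f : R -> R) (t : R) : continuous f -> 0 <= t ->
  (forall s, `|f s| <= K) -> `|primitive f t| <= K * t.
Proof.
move=> cf t0 fK; have [c _ ->] := primitive_mean_value cf t0.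
by rewrite normrM (ger0_norm t0) ler_wpM2r.
Qed.

Section flow_derivative.
Variables (w : R -> R) (phi : R -> R -> R).
Hypothesis phi_cont : forall x, continuous (phi x).
Hypothesis phiE : forall x s : R, 0 <= s ->
  phi x s = x + w s + primitive (b \o phi x) s.

Let drift_phi_cont x : continuous (b \o phi x).
Proof.
by move=> s; apply: continuous_comp; [exact: phi_cont|exact: drift_continuous].
Qed.

(** The difference of two solutions. The noise cancels in it, so it is
differentiable in time although the solutions themselves are not. *)
Let gap (x y s : R) := y - x + (primitive (b \o phi y) s - primitive (b \o phi x) s).

Let gapE (x y s : R) : 0 <= s -> phi y s - phi x s = gap x y s.
Proof. by move=> s0; rewrite /gap !phiE//; ring. Qed.

Let gap0 x y : gap x y 0 = y - x.
Proof. by rewrite /gap !primitive0; ring. Qed.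

Let gap_derive (x y s : R) : 0 < s ->
  is_derive s 1 (gap x y) (b (phi y s) - b (phi x s)).
Proof.
move=> s0.
have dy := is_derive_primitive (@drift_phi_cont y) s0.
have dx := is_derive_primitive (@drift_phi_cont x) s0.
apply: is_derive_eq (is_deriveD (is_derive_cst (y - x) s 1) (is_derive_sub dy dx)) _.
by rewrite add0r.
Qed.

Let gap_cont x y t : {within `[0, t], continuous (gap x y)}.
Proof.
move=> s; apply: cvgD; first exact: cvg_cst.
by apply: cvgB; apply: continuous_primitive.
Qed.

(** The function gap^2 exp(-2 K s) is nonincreasing because |b(u) - b(v)| is at
most K |u - v|; squaring keeps the argument free of absolute values under the
derivative. *)
Lemma flow_gronwall x y t : 0 <= t ->
  `|phi y t - phi x t| <= `|y - x| * expR (K * t).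
Proof.
move=> t0.
pose f (s : R) := gap x y s ^+ 2 * expR (- (K *+ 2) * s).
pose df (s : R) := (2 * gap x y s * (b (phi y s) - b (phi x s))
  - (K *+ 2) * gap x y s ^+ 2) * expR (- (K *+ 2) * s).
have fd (s : R) : s \in `]0, t[ -> is_derive s 1 f (df s).
  rewrite in_itv/= => /andP[s0 _]; have dg := gap_derive x y s0.
  apply: is_derive_eq (is_derive_mul (is_derive_mul dg dg)
    (is_derive_exp (is_derive_linear (- (K *+ 2)) s))) _.
  rewrite /df; ring.
have fc : {within `[0, t], continuous f}.
  move=> s; apply: cvgM; first by apply: cvgM; exact: gap_cont.
  apply: continuous_subspaceT => z.
  apply: continuous_comp; last exact: continuous_expR.
  by apply: cvgM; [exact: cvg_cst|exact: cvg_id].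
have [c c0t ft] := MVT_segment t0 fd fc.
have : f t <= f 0.
  rewrite -subr_le0 ft subr0 mulr_le0_ge0// /df mulr_le0_ge0 ?expR_ge0//.
  move: c0t; rewrite in_itv/= => /andP[c0 _].
  rewrite subr_le0 -gapE//; set D := phi y c - phi x c.
  have := drift_lipschitz (phi x c) (phi y c); rewrite -/D => bD.
  have h : D * (b (phi y c) - b (phi x c)) <= K * D ^+ 2.
    rewrite (le_trans (ler_norm _))// normrM -(real_normK (num_real D)).
    by rewrite expr2 mulrCA ler_wpM2l.
  rewrite mulr2n; lra.
rewrite /f mulr0 expR0 mulr1 gap0 -gapE// => h.
rewrite -ler_sqr ?nnegrE ?mulr_ge0 ?expR_ge0// exprMn !real_normK ?num_real//.
rewrite -ler_pdivrMr ?exprn_gt0 ?expR_gt0//.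
apply: le_trans h; rewrite ler_wpM2l ?sqr_ge0//.
by rewrite -expRM_natl -expRN ler_expR mulrA -mulNr mulr_natl.
Qed.

Lemma path_bounded (f : R -> R) (t : R) : continuous f ->
  exists B, forall s, s \in `[0, t] -> `|f s| <= B.
Proof.
move=> cf; have [t0|t0] := leP 0 t; last first.
  exists 0 => s; rewrite in_itv/= => /andP[s0 st].
  by have := le_lt_trans (le_trans s0 st) t0; rewrite ltxx.
have cn : {within `[0, t], continuous (fun s => `|f s|)}.
  by apply: continuous_subspaceT => s; apply: cvg_norm; exact: cf.
by have [c _ cmax] := EVT_max t0 cn; exists `|f c|.
Qed.

(** Let A be the primitive of b' along the solution from x, and h = y - x. The
time derivative of gap exp(-A) is exp(-A) times the first order Taylor remainder
of b between the two solutions. That remainder is o(|gap|) uniformly in time,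
since b' is uniformly continuous on the range of the path, and gap = O(h) by
Gronwall's inequality. Hence gap exp(-A) - h is o(h). *)
Lemma flow_derivative x t : 0 <= t ->
  derive1 (fun y => phi y t) x = expR (primitive (db \o phi x) t).
Proof.
move=> t0; apply: cvg_lim => //.
have cA : continuous (db \o phi x).
  by move=> s; apply: continuous_comp; [exact: phi_cont|exact: db_cont].
pose A := primitive (db \o phi x).
have A_le s : 0 <= s -> `|A s| <= K * s.
  by move=> s0; apply: primitive_norm_le => // r; exact: db_le.
have [B phiB] := path_bounded t (@phi_cont x).
apply/cvgrPdist_le => e e0.
(* exp(A t) undoes the integrating factor, t is the length of the interval, and
   the two factors exp(K t) bound exp(-A) and gap / h. *)
pose C := expR (A t) * (t * (expR (K * t) * expR (K * t))).
have C0 : 0 <= C by rewrite !mulr_ge0 ?expR_ge0.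
have eC : 0 < e / (C + 1) by rewrite divr_gt0// ltr_wpDl.
have [d d0 Hd] := uniform_continuity_segment (- B) B db_cont eC.
near=> h.
have h0 : h != 0 by near: h; exact: nbhs_dnbhs_neq.
have hd : `|h| * expR (K * t) < d.
  rewrite -ltr_pdivlMr ?expR_gt0//; near: h.
  by apply: dnbhs0_lt; rewrite divr_gt0 ?expR_gt0.
pose y := h + x.
pose f (s : R) := gap x y s * expR (- A s).
pose df (s : R) := (b (phi y s) - b (phi x s) - db (phi x s) * gap x y s) * expR (- A s).
have fd (s : R) : s \in `]0, t[ -> is_derive s 1 f (df s).
  rewrite in_itv/= => /andP[s0 _]; have dg := gap_derive x y s0.
  have dA := is_derive_primitive cA s0.
  apply: is_derive_eq (is_derive_mul dg (is_derive_exp (is_deriveN dA))) _.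
  rewrite /df /=; ring.
have fc : {within `[0, t], continuous f}.
  move=> s; apply: cvgM; first exact: gap_cont.
  apply: continuous_cvg; first exact: continuous_expR.
  by apply: cvgN; exact: continuous_primitive.
have [c] := MVT_segment t0 fd fc.
rewrite in_itv/= => /andP[c0 ct].
rewrite /f [A 0]primitive0 subr0 oppr0 expR0 mulr1 gap0 -gapE// => ft.
have yx : y - x = h by rewrite /y addrK.
have gc : `|gap x y c| <= `|h| * expR (K * t).
  rewrite -gapE//; apply: le_trans (flow_gronwall x y c0) _.
  by rewrite yx ler_wpM2l// ler_expR ler_wpM2l.
have dfc : `|df c| <= e / (C + 1) * (`|h| * expR (K * t)) * expR (K * t).
  rewrite /df normrM (ger0_norm (expR_ge0 _)).
  apply: ler_pM; rewrite ?normr_ge0 ?expR_ge0//; last first.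
    rewrite ler_expR; apply: le_trans (_ : K * c <= _); last by rewrite ler_wpM2l.
    by rewrite (le_trans (ler_norm _))// normrN A_le.
  have [z zc ->] := drift_mean_value (phi x c) (phi y c).
  rewrite gapE// -mulrBl normrM; apply: ler_pM => //.
  rewrite distrC ltW// Hd//.
    by rewrite in_itv/= -ler_norml phiB// in_itv/= c0.
  rewrite (le_lt_trans zc)// distrC gapE//; exact: le_lt_trans hd.
move: (df c) dfc ft => D dfc ft.
have -> : expR (A t) - h^-1 *: (phi (h + x) t - phi x t) =
    - (expR (A t) * h^-1 * (D * t)).
  rewrite -ft -/y yx /GRing.scale/= expRN.
  by field; rewrite h0 gt_eqF ?expR_gt0.
rewrite normrN !normrM (ger0_norm (expR_ge0 _)) normfV (ger0_norm t0).
apply: (@le_trans _ _ (expR (A t) * `|h|^-1 *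
    (e / (C + 1) * (`|h| * expR (K * t)) * expR (K * t) * t))).
  apply: ler_wpM2l; first by rewrite mulr_ge0 ?expR_ge0// invr_ge0.
  exact: ler_wpM2r.
have -> : expR (A t) * `|h|^-1 *
    (e / (C + 1) * (`|h| * expR (K * t)) * expR (K * t) * t) =
    e * C / (C + 1).
  rewrite /C; field.
  rewrite normr_eq0 h0 gt_eqF//.
  by rewrite -/C ltr_wpDl.
by rewrite ler_pdivrMr ?ltr_wpDl// ler_pM2l// lerDl.
Unshelve. all: by end_near. Qed.

End flow_derivative.

(** Euler scheme for drift a, step h and noise increments xi. The drift is kept
as a parameter because the scheme with drift 0, which is the path of the noise
itself, is the other side of the change of measure. *)
Fixpoint euler (a : R -> R) (x h : R) (xi : nat -> R) (k : nat) : R :=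
  if k is j.+1 then
    euler a x h xi j + a (euler a x h xi j) * h + xi j
  else x.

Definition mesh_incr (w : R -> R) (t : R) (n k : nat) : R :=
  w (k.+1%:R * mesh t n) - w (k%:R * mesh t n).

Lemma euler_no_drift (w : R -> R) (x t : R) n k : w 0 = 0 ->
  euler (cst 0) x (mesh t n) (mesh_incr w t n) k = x + w (k%:R * mesh t n).
Proof.
move=> w0; elim: k => [|k IH] /=; first by rewrite mul0r w0 addr0.
by rewrite IH /mesh_incr mul0r addr0 -addrA subrKC.
Qed.

Section euler_convergence.
Variables (w phi : R -> R) (x t : R).
Hypothesis t_ge0 : 0 <= t.
Hypothesis w0 : w 0 = 0.
Hypothesis phi_cont : continuous phi.
Hypothesis phiE : forall s : R, 0 <= s -> phi s = x + w s + primitive (b \o phi) s.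

Let drift_phi_cont : continuous (b \o phi).
Proof.
by move=> s; apply: continuous_comp; [exact: phi_cont|exact: drift_continuous].
Qed.

Let eul n := euler b x (mesh t n) (mesh_incr w t n).

(** Discrete Gronwall inequality: one step multiplies the error by 1 + K h and
adds K h om, where om is the oscillation of the solution over one step, and
1 + K h <= exp(K h). *)
Lemma euler_error (om : R) n :
  (forall u v, u \in `[0, t] -> `|u - v| <= mesh t n ->
     `|phi u - phi v| <= om) ->
  forall k, (k <= n.+1)%N ->
  `|phi (k%:R * mesh t n) - eul n k| <= om * (expR (K * (k%:R * mesh t n)) - 1).
Proof.
move=> mod_cont.
have om0 : 0 <= om.
  apply: le_trans (mod_cont 0 0 _ _); first by rewrite subrr normr0.
    by rewrite in_itv/= lexx.
  by rewrite subrr normr0 mesh_ge0.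
elim=> [_|k IH kn].
  by rewrite !mul0r mulr0 expR0 subrr mulr0 phiE// w0 primitive0 !addr0 subrr normr0.
have {IH} := IH (ltnW kn).
set u := k%:R * mesh t n; rewrite mesh_step -/u => IH.
have [c] := mesh_mean_value t_ge0 kn
  (continuous_primitive (t := t) drift_phi_cont)
  (fun s s0 => is_derive_primitive drift_phi_cont s0).
rewrite mesh_step -/u in_itv/= => /andP[uc cu] Fc.
have u0 : 0 <= u by exact: mesh_pt_ge0.
have h0 : 0 <= mesh t n by exact: mesh_ge0.
have ut : u <= t by rewrite mesh_pt_le// ltnW.
have -> : phi (u + mesh t n) - eul n k.+1 =
    (phi u - eul n k) + (b (phi c) - b (eul n k)) * mesh t n.
  rewrite /eul /= -/(eul n k) /mesh_incr mesh_step -/u.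
  rewrite (phiE (addr_ge0 u0 h0)) (phiE u0).
  rewrite mulrBl -Fc; ring.
apply: (le_trans (ler_normD _ _)).
rewrite normrM (ger0_norm h0).
have step : `|b (phi c) - b (eul n k)| <= K * (om + `|phi u - eul n k|).
  apply: le_trans (drift_lipschitz _ _) _; rewrite ler_wpM2l//.
  rewrite -(subrKA (phi u)) (le_trans (ler_normD _ _))// lerD2r distrC.
  apply: mod_cont; first by rewrite in_itv/= u0.
  by rewrite distrC ger0_norm ?subr_ge0// lerBlDl.
set r := `|phi u - eul n k| in IH step *.
apply: (@le_trans _ _ (r + K * (om + r) * mesh t n)).
  by rewrite lerD2l ler_wpM2r.
rewrite [K * (u + _)]mulrDr expRD.
have e1 : 1 + K * mesh t n <= expR (K * mesh t n) by exact: expR_ge1Dx.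
set E := expR (K * u) in IH *.
have E0 : 0 <= E by exact: expR_ge0.
have Kh : 0 <= K * mesh t n by rewrite mulr_ge0.
apply: (@le_trans _ _ ((1 + K * mesh t n) * (om * (E - 1)) + om * (K * mesh t n))).
  have -> : r + K * (om + r) * mesh t n = (1 + K * mesh t n) * r + om * (K * mesh t n).
    by ring.
  by rewrite lerD2r ler_wpM2l// addr_ge0.
have -> : (1 + K * mesh t n) * (om * (E - 1)) + om * (K * mesh t n) =
  om * ((1 + K * mesh t n) * E - 1) by ring.
by rewrite ler_wpM2l// lerD2r mulrC ler_wpM2l.
Qed.

(** Since g is only continuous, the error of the scheme is made small compared
with a modulus of uniform continuity of g on the range of the solution; the rest
is a Riemann sum. *)
Lemma euler_sum_cvg (g : R -> R) : continuous g ->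
  \sum_(k < n.+1) g (eul n k) * mesh t n @[n --> \oo] --> primitive (g \o phi) t.
Proof.
move=> cg.
have cgp : continuous (g \o phi).
  by move=> s; apply: continuous_comp; [exact: phi_cont|exact: cg].
apply/cvgrPdist_le => e e0.
have e20 : 0 < e / 2 by rewrite divr_gt0.
have et0 : 0 < e / 2 / (t + 1) by rewrite divr_gt0// ltr_wpDl.
have [B phiB] := path_bounded t phi_cont.
have [d d0 Hd] := uniform_continuity_segment (- B) B cg et0.
have dK : 0 < d / expR (K * t) by rewrite divr_gt0 ?expR_gt0.
have [m m0 Hm] := uniform_continuity_segment 0 t phi_cont dK.
have /cvgrPdist_lt/(_ _ m0) := mesh_cvg0 t.
have /cvgrPdist_le/(_ _ e20) := riemann_sum_primitive t_ge0 cgp.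
apply: filterS2 => n RS; rewrite sub0r normrN ger0_norm ?mesh_ge0// => nm.
rewrite -(subrKA (riemann_sum (g \o phi) t n)) (le_trans (ler_normD _ _))//.
rewrite [leRHS]splitr lerD// /riemann_sum -sumrB (le_trans (ler_norm_sum _ _ _))//.
apply: (@le_trans _ _ (\sum_(k < n.+1) e / 2 / (t + 1) * mesh t n)); last first.
  rewrite sumr_const card_ord -[_ *+ n.+1]mulr_natl mulrCA mesh_total.
  rewrite mulrAC ler_pdivrMr; last by rewrite ltr_wpDl.
  by apply: ler_wpM2l; [exact: ltW|rewrite lerDl].
apply: ler_sum => k _.
rewrite -mulrBl normrM (ger0_norm (mesh_ge0 n t_ge0)) ler_wpM2r ?mesh_ge0//.
have kt : k%:R * mesh t n \in `[0, t].
  by rewrite in_itv/= mesh_pt_ge0// mesh_pt_le// ltnW.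
apply/ltW/Hd; first by rewrite in_itv/= -ler_norml phiB.
have := @euler_error (d / expR (K * t)) n _ k (ltnW (ltn_ord k)).
have uv u v : u \in `[0, t] -> `|u - v| <= mesh t n ->
    `|phi u - phi v| <= d / expR (K * t).
  by move=> ut uv; apply/ltW/Hm => //; exact: le_lt_trans nm.
move=> /(_ uv) err; apply: le_lt_trans err _.
rewrite mulrAC ltr_pdivrMr ?expR_gt0// ltr_pM2l//.
apply: (@lt_le_trans _ _ (expR (K * (k%:R * mesh t n)))).
  by rewrite ltrBlDr ltrDl.
by rewrite ler_expR ler_wpM2l// mesh_pt_le// ltnW.
Qed.

End euler_convergence.

End pathwise.

(** * Bounded random variables *)
Section bounded_measurable.
Context {d : measure_display} {T : measurableType d} {R : realType}.

Definition bounded_measurable (f : T -> R) : Prop :=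
  measurable_fun setT f /\ exists C, forall x, `|f x| <= C.

Variable P : probability T R.

Lemma bounded_measurable_integrable (f : T -> R) :
  bounded_measurable f -> P.-integrable setT (EFin \o f).
Proof.
move=> [mf [C fC]]; apply: measurable_bounded_integrable => //.
  exact: le_lt_trans (probability_le1 P measurableT) (ltry _).
exists C; split; first exact: num_real.
by move=> x Cx y _; apply: le_trans (fC y) _; exact: ltW.
Qed.

Lemma bounded_measurable_EFin_Rintegral (f : T -> R) : bounded_measurable f ->
  (\int[P]_x f x)%:E = (\int[P]_x (f x)%:E)%E.
Proof.
move=> bf; rewrite fineK//; apply: integrable_fin_num => //.
exact: bounded_measurable_integrable.
Qed.

Lemma bounded_measurable_cst (c : R) : bounded_measurable (cst c : T -> R).
Proof. by split => //; exists `|c|. Qed.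

Lemma bounded_measurable_between (f : T -> R) (C : R) :
  measurable_fun setT f -> (forall x, 0 <= f x <= C) -> bounded_measurable f.
Proof.
move=> mf fC; split => //; exists C => x.
by have /andP[f0 f1] := fC x; rewrite ger0_norm.
Qed.

Lemma bounded_measurableM (f g : T -> R) : bounded_measurable f ->
  bounded_measurable g -> bounded_measurable (fun x => f x * g x).
Proof.
move=> [mf [C fC]] [mg [D gD]]; split; first exact: measurable_funM.
by exists (C * D) => x; rewrite normrM ler_pM.
Qed.

Lemma bounded_measurableD (f g : T -> R) : bounded_measurable f ->
  bounded_measurable g -> bounded_measurable (fun x => f x + g x).
Proof.
move=> [mf [C fC]] [mg [D gD]]; split; first exact: measurable_funD.
by exists (C + D) => x; rewrite (le_trans (ler_normD _ _))// lerD.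
Qed.

Lemma bounded_measurableX (f : T -> R) n : bounded_measurable f ->
  bounded_measurable (fun x => f x ^+ n).
Proof.
move=> bf; elim: n => [|n IH]; first exact: bounded_measurable_cst.
under eq_fun do rewrite exprS; exact: bounded_measurableM.
Qed.

Lemma bounded_measurable_sum (I : Type) (r : seq I) (F : I -> T -> R) :
  (forall i, bounded_measurable (F i)) ->
  bounded_measurable (fun x => \sum_(i <- r) F i x).
Proof.
move=> bF; elim: r => [|i r IH].
  by under eq_fun do rewrite big_nil; exact: bounded_measurable_cst.
under eq_fun do rewrite big_cons; exact: bounded_measurableD.
Qed.

Lemma bounded_measurable_le_Rintegral (f g : T -> R) : bounded_measurable f ->
  bounded_measurable g -> (forall x, f x <= g x) ->
  \int[P]_x f x <= \int[P]_x g x.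
Proof.
move=> bf bg fg; apply: le_Rintegral => //;
  exact: bounded_measurable_integrable.
Qed.

Lemma bounded_measurable_RintegralZl (c : R) (f : T -> R) :
  bounded_measurable f -> \int[P]_x (c * f x) = c * \int[P]_x f x.
Proof.
by move=> bf; rewrite RintegralZl//; exact: bounded_measurable_integrable.
Qed.

Lemma Rintegral_probability_cst (c : R) : \int[P]_x c = c.
Proof.
by rewrite Rintegral_cst// [X in fine X](@probability_setT _ _ _ P) mulr1.
Qed.

Lemma bounded_measurable_Rintegral_sum (I : Type) (r : seq I) (F : I -> T -> R) :
  (forall i, bounded_measurable (F i)) ->
  \int[P]_x (\sum_(i <- r) F i x) = \sum_(i <- r) \int[P]_x F i x.
Proof.
move=> bF; elim: r => [|i r IH].
  under eq_Rintegral do rewrite big_nil.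
  by rewrite big_nil Rintegral_probability_cst.
under eq_Rintegral do rewrite big_cons.
rewrite big_cons RintegralD ?IH//; apply: bounded_measurable_integrable => //.
exact: bounded_measurable_sum.
Qed.

(** Bounded convergence in real-valued form, with the measurability of the limit
as part of the conclusion. *)
Lemma bounded_convergence (f_ : nat -> T -> R) (f : T -> R) (C : R) :
  (forall n, measurable_fun setT (f_ n)) ->
  (forall n x, `|f_ n x| <= C) ->
  (forall x, f_ n x @[n --> \oo] --> f x) ->
  bounded_measurable f /\
  (\int[P]_x f_ n x @[n --> \oo] --> \int[P]_x f x).
Proof.
move=> mf_ fC cf.
have mf : measurable_fun setT f.
  by apply: (measurable_fun_cvg (h := f_)) => // x _; exact: cf.
have bf : bounded_measurable f.
  split => //; exists C => x.
  have /cvg_norm cn := cf x.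
  by apply: (cvgr_to_le cn); exact: nearW.
split => //.
have iC : P.-integrable setT (EFin \o cst C).
  exact/bounded_measurable_integrable/bounded_measurable_cst.
have mEf n : measurable_fun setT (fun x => (f_ n x)%:E).
  by apply/measurable_EFinP; exact: mf_.
have mEg : measurable_fun setT (EFin \o f) by exact/measurable_EFinP.
have aecf : {ae P, forall x, setT x ->
    (f_ n x)%:E @[n --> \oo] --> (EFin \o f) x}.
  by apply: aeW => x _; apply/fine_cvgP; split; [exact: nearW|exact: cf].
have aefC : {ae P, forall x n, setT x ->
    (`|(f_ n x)%:E| <= (EFin \o cst C) x)%E}.
  by apply: aeW => x n _; rewrite /= lee_fin.
have [_ _ cv] := dominated_convergence measurableT mEf mEg aecf iC aefC.
by apply: fine_cvg; rewrite bounded_measurable_EFin_Rintegral.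
Qed.

End bounded_measurable.

(** * One Gaussian step of the change of measure *)
Section gaussian_shift.
Context {R : realType}.
Local Notation mu := (@lebesgue_measure R).

Lemma lebesgue_measure_translation (m : R) (A : set R) : measurable A ->
  pushforward mu ((fun z => z + m) : _ -> measurableTypeR R) A = mu A.
Proof.
move=> mA; have mt : measurable_fun setT ((fun z => z + m) : R -> measurableTypeR R).
  by apply: measurable_funD.
apply/esym/lebesgue_measure_unique => //= _ [[a b]] _ <-.
rewrite /pushforward (_ : _ @^-1` _ = `]a - m, b - m]%classic).
  rewrite !lebesgue_measure_itv/= !lte_fin ltrD2r.
  by case: ifP => // _; rewrite -!EFinB opprB addrA subrK.
by apply/seteqP; split => z /=; rewrite !in_itv/= ltrBlDr lerBrDr.
Qed.

Lemma ge0_integral_translation (m : R) (f : R -> \bar R) :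
  measurable_fun setT f -> (forall z, (0 <= f z)%E) ->
  (\int[mu]_z f (z + m)%R = \int[mu]_z f z)%E.
Proof.
move=> mf f0.
have mt : measurable_fun setT ((fun z => z + m) : R -> measurableTypeR R).
  by apply: measurable_funD.
transitivity
  (\int[pushforward mu ((fun z => (z + m)%R) : R -> measurableTypeR R)]_z f z)%E.
  by rewrite ge0_integral_pushforward.
by apply: eq_measure_integral => A mA _; exact: lebesgue_measure_translation.
Qed.

Variable s : R.
Hypothesis s_gt0 : 0 < s.

Let s_neq0 : s != 0. Proof. by rewrite gt_eqF. Qed.

(** A normal law is defined by its values on sets as integrals of a density, so
the density is its Radon-Nikodym derivative by uniqueness. *)
Lemma integral_normal_prob (f : R -> R) :
  bounded_measurable f ->
  (\int[normal_prob 0 s]_z (f z)%:E =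
   \int[mu]_z ((f z)%:E * (normal_pdf 0 s z)%:E))%E.
Proof.
move=> bf; have iff := bounded_measurable_integrable (normal_prob 0 s) bf.
have mf : measurable_fun setT (EFin \o f) by apply/measurable_EFinP; case: bf.
rewrite -(Radon_Nikodym_change_of_variables (normal_prob_dominates 0 s))//=.
apply: ae_eq_integral => //.
- apply: emeasurable_funM => //; apply: (measurable_int mu).
  by apply: Radon_Nikodym_integrable; exact: normal_prob_dominates.
- apply: emeasurable_funM => //=; apply/measurableT_comp => //=.
  exact: measurable_normal_pdf.
- apply: ae_eqe_mul2l => /=.
  rewrite Radon_NikodymE//=; first exact: normal_prob_dominates.
  move=> numu; case: cid => /= h [h1 h2 h3].
  apply: integral_ae_eq => //=.
    by apply/measurableT_comp => //; exact: measurable_normal_pdf.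
  by move=> E ET mE; rewrite -h3.
Qed.

Definition gauss_mean (u : R -> R) (y : R) : R :=
  \int[normal_prob 0 s]_z u (y + z).

Definition bounded_nonneg (u : R -> R) : Prop :=
  bounded_measurable u /\ forall x, 0 <= u x.

Lemma bounded_measurable_shift (u : R -> R) (y : R) :
  bounded_measurable u -> bounded_measurable (fun z => u (y + z)).
Proof.
move=> [mu0 [C uC]]; split; last by exists C.
by apply: measurableT_comp => //; exact: measurable_funD.
Qed.

Lemma normal_pdf_shift (m z : R) : normal_pdf m s (z + m) = normal_pdf 0 s z.
Proof. by rewrite !normal_pdfE// /normal_fun addrK subr0. Qed.

(** Completing the square. Divided by the centred density, this computes the
second moment of the likelihood ratio of N(m, s^2) and N(0, s^2): the right-hand
side integrates to exp(m^2 / s^2). *)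
Lemma normal_pdf_square (m z : R) :
  normal_pdf m s z ^+ 2 =
  expR (m ^+ 2 / s ^+ 2) * normal_pdf (m *+ 2) s z * normal_pdf 0 s z.
Proof.
rewrite !normal_pdfE// /normal_fun.
set a := - (z - m) ^+ 2 / _; set a0 := - (z - 0) ^+ 2 / _; set a2 := - _ / _.
have aE : expR a ^+ 2 = expR (m ^+ 2 / s ^+ 2) * expR a2 * expR a0.
  by rewrite -expRM_natl -!expRD; congr expR; rewrite /a /a0 /a2; field.
by rewrite exprMn aE; ring.
Qed.

Lemma gauss_mean_shift (u : R -> R) (y m : R) : bounded_nonneg u ->
  (gauss_mean u (y + m))%:E = (\int[mu]_z (u (y + z) * normal_pdf m s z)%:E)%E.
Proof.
move=> [bu u0]; have bs := bounded_measurable_shift (y + m) bu.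
rewrite bounded_measurable_EFin_Rintegral//.
rewrite integral_normal_prob//.
rewrite -[RHS](ge0_integral_translation m) => [||z]; last 2 first.
- apply/measurable_EFinP; apply: measurable_funM; last exact: measurable_normal_pdf.
  by have [] := bounded_measurable_shift y bu.
- by rewrite lee_fin mulr_ge0// normal_pdf_ge0.
by apply: eq_integral => z _; rewrite normal_pdf_shift addrAC addrA.
Qed.

(** The translation by m is moved from u to the density, which becomes that of
N(m, s^2). Cauchy-Schwarz against the centred density then leaves the second
moment of the likelihood ratio, which is E below. The inequality is proved in
the form A <= (l V + E / l) / 2 for all l > 0, where it holds pointwise under
the integral. *)
Lemma gauss_mean_cauchy_schwarz (u : R -> R) (y m : R) : bounded_nonneg u ->
  gauss_mean u (y + m) ^+ 2 <=
  expR (m ^+ 2 / s ^+ 2) * gauss_mean (fun z => u z ^+ 2) y.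
Proof.
move=> bu; have [[mu0 [C uC]] u0] := bu.
have bu2 : bounded_nonneg (fun z => u z ^+ 2).
  by split=> [|x]; [apply: bounded_measurableX; case: bu|exact: exprn_ge0].
set E := expR _; set V := gauss_mean _ y; set A := gauss_mean u (y + m).
have A0 : 0 <= A by apply: Rintegral_ge0 => z _; exact: u0.
have key (l : R) : 0 < l -> A <= l / 2 * V + (l^-1 / 2) * E.
  move=> l0.
  have l20 : 0 <= l / 2 by rewrite divr_ge0 ?ltW.
  have l2V : 0 <= l^-1 / 2 * E by rewrite !mulr_ge0 ?expR_ge0 ?invr_ge0 ?ltW.
  have muy : measurable_fun setT (fun z => u (y + z)).
    by apply: measurableT_comp => //; exact: measurable_funD.
  rewrite -lee_fin gauss_mean_shift// EFinD !EFinM.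
  have -> : V%:E = (\int[mu]_z (u (y + z) ^+ 2 * normal_pdf 0 s z)%:E)%E.
    by rewrite -(gauss_mean_shift y 0 bu2) addr0.
  rewrite -[X in (_ + X)%E]mule1 -(integral_normal_pdf (m *+ 2) s).
  have mp k : measurable_fun setT (fun z => (normal_pdf k s z)%:E).
    by apply/measurable_EFinP; exact: measurable_normal_pdf.
  have mq : measurable_fun setT (fun z => (u (y + z) ^+ 2 * normal_pdf 0 s z)%:E).
    apply/measurable_EFinP; apply: measurable_funM; last exact: measurable_normal_pdf.
    exact: measurable_funX.
  rewrite -!EFinM -ge0_integralZl_EFin//; last first.
    by move=> z _; rewrite lee_fin mulr_ge0 ?exprn_ge0 ?normal_pdf_ge0.
  have -> : ((l^-1 / 2 * E)%:E * \int[mu]_z (normal_pdf (m *+ 2) s z)%:E =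
      \int[mu]_z ((l^-1 / 2 * E)%:E * (normal_pdf (m *+ 2) s z)%:E))%E.
    rewrite ge0_integralZl_EFin//.
      by move=> z _; rewrite lee_fin normal_pdf_ge0.
    exact: mp.
  have mp2 : measurable_fun setT
      (fun z => ((l^-1 / 2 * E)%:E * (normal_pdf (m *+ 2) s z)%:E)%E).
    exact: (measurable_funeM _ (mp _)).
  have mq2 : measurable_fun setT
      (fun z => ((l / 2)%:E * (u (y + z) ^+ 2 * normal_pdf 0 s z)%:E)%E).
    exact: (measurable_funeM _ mq).
  rewrite -ge0_integralD//; first last.
  - move=> z _; rewrite -EFinM lee_fin; apply: mulr_ge0 => //;
      by rewrite ?mulr_ge0 ?sqr_ge0 ?normal_pdf_ge0.
  - move=> z _; rewrite -EFinM lee_fin; apply: mulr_ge0 => //;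
      by rewrite ?mulr_ge0 ?sqr_ge0 ?normal_pdf_ge0.
  apply: ge0_le_integral => //.
  - by move=> z _; rewrite lee_fin mulr_ge0// normal_pdf_ge0.
  - by apply/measurable_EFinP; apply: measurable_funM => //; exact: measurable_normal_pdf.
  - by apply: emeasurable_funD.
  move=> z _; rewrite -!EFinM -EFinD lee_fin.
  have p0 : 0 < normal_pdf 0 s z.
    by rewrite normal_pdfE// mulr_gt0 ?expR_gt0 ?normal_peak_gt0.
  have := normal_pdf_square m z; rewrite -/E.
  set p := normal_pdf 0 s z in p0 *; set q := normal_pdf m s z.
  set r := normal_pdf _ s z; set v := u (y + z) => qE.
  have -> : l^-1 / 2 * E * r = l^-1 / 2 * (q ^+ 2 / p).
    by rewrite qE mulfK ?gt_eqF// mulrA.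
  have : 0 <= (l * v * p - q) ^+ 2 by exact: sqr_ge0.
  rewrite -(pmulr_lge0 _ (_ : 0 < (l * p *+ 2)^-1)); last first.
    by rewrite invr_gt0 pmulrn_lgt0// mulr_gt0.
  rewrite -subr_ge0; congr (0 <= _).
  by field; rewrite !gt_eqF.
have [A_le0|A_gt0] := leP A 0.
  have -> : A = 0 by apply/eqP; rewrite eq_le A_le0.
  by rewrite expr0n/= mulr_ge0 ?expR_ge0//; apply: Rintegral_ge0 => z _; exact: sqr_ge0.
have E0 : 0 < E by exact: expR_gt0.
(* For this l the term E / l equals A, and can be absorbed on the left. *)
have := key (E / A) (divr_gt0 E0 A_gt0).
have -> : E / A / 2 * V + (E / A)^-1 / 2 * E = (E * V / A + A) / 2.
  by field; rewrite !gt_eqF.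
by rewrite ler_pdivlMr// mulr_natr mulr2n lerD2r ler_pdivlMr// -expr2.
Qed.

End gaussian_shift.

(** * The change of measure along the Euler scheme *)
Section euler_expectation_kernel.
Context {R : realType}.
Variable s : R.
Hypothesis s_gt0 : 0 < s.

Lemma gauss_mean_bounded (u : R -> R) (C : R) :
  measurable_fun setT u -> (forall x, 0 <= u x <= C) ->
  forall y, 0 <= gauss_mean s u y <= C.
Proof.
move=> mu0 uC y.
have bu := bounded_measurable_shift y (bounded_measurable_between mu0 uC).
apply/andP; split.
  by apply: Rintegral_ge0 => z _; have /andP[] := uC (y + z).
rewrite -[leRHS](Rintegral_probability_cst (normal_prob 0 s)).
apply: bounded_measurable_le_Rintegral => //.
  exact: bounded_measurable_cst.
by move=> z; have /andP[] := uC (y + z).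
Qed.

Lemma measurable_gauss_mean (u : R -> R) (C : R) :
  measurable_fun setT u -> (forall x, 0 <= u x <= C) ->
  measurable_fun setT (gauss_mean s u).
Proof.
move=> mu0 uC.
have mf : measurable_fun setT (fun yz : R * R => (u (yz.1 + yz.2))%:E).
  by apply/measurable_EFinP; apply: measurableT_comp => //; exact: measurable_funD.
have f0 (yz : R * R) : (0 <= (u (yz.1 + yz.2))%:E)%E.
  by rewrite lee_fin; have /andP[] := uC (yz.1 + yz.2).
have := @measurable_fun_fubini_tonelli_F _ _ _ _ R (normal_prob 0 s) _ mf f0.
by move=> mF; exact: (measurableT_comp (@fine_measurable R setT measurableT) mF).
Qed.

(** Expected product of g over the first n positions of the Euler scheme with
drift a started at x, written through the Markov property by averaging over the
first increment. *)
Fixpoint euler_value (a g : R -> R) (h : R) (n : nat) (x : R) : R :=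
  if n is m.+1 then g x * gauss_mean s (euler_value a g h m) (x + a x * h)
  else 1.

Section value_properties.
Variables (a g : R -> R) (h C : R).
Hypotheses (ma : measurable_fun setT a) (mg : measurable_fun setT g).
Hypothesis gC : forall x, 0 <= g x <= C.

Lemma euler_value_bounded n :
  measurable_fun setT (euler_value a g h n) /\
  forall x, 0 <= euler_value a g h n x <= C ^+ n.
Proof.
elim: n => [|n [mn IH]] /=; first by split=> // x; rewrite expr0 ler01 lexx.
split.
  apply: measurable_funM => //.
  apply: measurableT_comp; first exact: measurable_gauss_mean IH.
  by apply: measurable_funD => //; exact: measurable_funM.
move=> x; have /andP[g0 g1] := gC x.
have /andP[v0 v1] := gauss_mean_bounded mn IH (x + a x * h).
by rewrite mulr_ge0//= exprS ler_pM.
Qed.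

End value_properties.

(** Discrete Girsanov and Cauchy-Schwarz: with m = a(x) h and s^2 = h each step
costs exp(a(x)^2 h). The squared weight on the right is what remains of g after
Cauchy-Schwarz. *)
Lemma euler_value_girsanov (a g : R -> R) (B C : R) n x :
  measurable_fun setT a -> measurable_fun setT g ->
  (forall x, 0 <= g x <= C) -> (forall x, `|a x| <= B) ->
  euler_value a g (s ^+ 2) n x ^+ 2 <=
  expR (n%:R * (B ^+ 2 * s ^+ 2)) *
  euler_value (cst 0) (fun y => g y ^+ 2) (s ^+ 2) n x.
Proof.
move=> ma mg gC aB; set h := s ^+ 2.
have h0 : 0 < h by rewrite exprn_gt0.
elim: n x => [|n IH] x /=; first by rewrite mul0r expR0 mul1r expr1n.
have [mn vn] := euler_value_bounded h ma mg gC n.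
have m0 : measurable_fun setT (cst 0 : R -> R) by [].
have mg2 : measurable_fun setT (fun y => g y ^+ 2) by exact: measurable_funX.
have g2C y : 0 <= g y ^+ 2 <= C ^+ 2.
  by have /andP[g0 g1] := gC y; rewrite sqr_ge0 lerXn2r// nnegrE (le_trans g0).
have [mn0 vn0] := euler_value_bounded h m0 mg2 g2C n.
have bn : bounded_nonneg (euler_value a g h n).
  split; last by move=> y; have /andP[] := vn y.
  exact: bounded_measurable_between mn vn.
rewrite mul0r addr0 exprMn [leRHS]mulrCA ler_wpM2l ?sqr_ge0//.
apply: le_trans (gauss_mean_cauchy_schwarz s_gt0 _ _ bn) _.
have -> : (a x * h) ^+ 2 / s ^+ 2 = a x ^+ 2 * h.
  by rewrite -/h; field; rewrite gt_eqF.
apply: (@le_trans _ _ (expR (B ^+ 2 * h) * (expR (n%:R * (B ^+ 2 * h)) *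
    gauss_mean s (euler_value (cst 0) (fun y => g y ^+ 2) h n) x))); last first.
  by rewrite mulrA -expRD -natr1 mulrDl mul1r addrC.
have bv := bounded_measurable_shift x (bounded_measurable_between mn vn).
have bv0 := bounded_measurable_shift x (bounded_measurable_between mn0 vn0).
apply: ler_pM; rewrite ?expR_ge0//.
- by apply: Rintegral_ge0 => z _; exact: sqr_ge0.
- rewrite ler_expR ler_wpM2r ?(ltW h0)//.
  rewrite -[a x ^+ 2](real_normK (num_real _)).
  by rewrite lerXn2r ?nnegrE// (le_trans (normr_ge0 (a x))).
rewrite /gauss_mean -bounded_measurable_RintegralZl//.
apply: bounded_measurable_le_Rintegral => //.
- exact: bounded_measurableX.
- exact: bounded_measurableM (bounded_measurable_cst _) bv0.
Qed.

End euler_expectation_kernel.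

(** * Independence and Gaussian random walks *)
Section freezing.
Context {d : measure_display} {Omega : measurableType d} {R : realType}.
Variables (P : probability Omega R) (gamma : probability (measurableTypeR R) R).
Variable G : set (set Omega).
Hypothesis G_meas : G `<=` measurable.
Hypothesis G_setI : setI_closed G.
Hypothesis G_setT : G setT.
Variable xi : Omega -> R.
Hypothesis xi_meas : measurable_fun setT xi.
Hypothesis G_indep : forall E C, G E -> measurable C ->
  P (E `&` xi @^-1` C) = (P E * gamma C)%E.

Let sG_meas E : <<s G >> E -> measurable E.
Proof. exact: (smallest_sub (@sigma_algebra_measurable _ Omega) G_meas). Qed.

(** Two finite measures that agree on a pi-system agree on the sigma-algebra it
generates. *)
Lemma generated_indep E C : <<s G >> E -> measurable C ->
  P (E `&` xi @^-1` C) = (P E * gamma C)%E.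
Proof.
move=> GE mC.
have mxC : measurable (xi @^-1` C) by rewrite -[X in measurable X]setTI; exact: xi_meas.
have gC0 : 0 <= fine (gamma C) by rewrite fine_ge0.
pose m1 := mrestr P mxC.
pose m2 := mscale (NngNum gC0) P.
have gfin : (fine (gamma C))%:E = gamma C by rewrite fineK// fin_num_measure.
have E2 A : m2 A = (P A * gamma C)%E by rewrite /m2/= /mscale/= gfin muleC.
transitivity (m2 E); last exact: E2.
change (m1 E = m2 E).
apply: (@g_sigma_algebra_measure_unique _ R Omega G G_meas (fun=> setT)) => //.
- by rewrite bigcup_const//; exists 0%N.
- by move=> A GA; transitivity (P A * gamma C)%E; [exact: G_indep|exact/esym/E2].
- move=> _; rewrite /m1 /mrestr/= (le_lt_trans (probability_le1 _ _)) ?ltry//.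
  exact: measurableI.
Qed.

(** Taking the past as a measurable space of its own, generated by G, the law of
the pair formed by the past and xi is a product measure, and Tonelli's theorem
integrates xi out with the past frozen. *)
Lemma freezing (H : g_sigma_algebraType G * measurableTypeR R -> \bar R) :
  measurable_fun setT H -> (forall z, (0 <= H z)%E) ->
  (\int[P]_w H (w, xi w) = \int[P]_w \int[gamma]_z H (w, z))%E.
Proof.
move=> mH H0.
pose idG : Omega -> g_sigma_algebraType G := id.
have midG : measurable_fun setT idG.
  by move=> _ A mA; rewrite setTI; exact: sG_meas.
pose pr : Omega -> g_sigma_algebraType G * measurableTypeR R := fun w => (idG w, xi w).
have mpr : measurable_fun setT pr by exact: measurable_fun_pair.
pose idG' : {mfun Omega >-> g_sigma_algebraType G} :=
  HB.pack idG (isMeasurableFun.Build _ _ _ _ _ midG).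
pose PG : probability (g_sigma_algebraType G) R := distribution P idG'.
transitivity (\int[pushforward P pr]_z H z)%E.
  by rewrite ge0_integral_pushforward.
transitivity (\int[PG \x gamma]_z H z)%E.
  apply: eq_measure_integral => A mA _; apply/esym.
  apply: (@product_measure_unique _ _ _ _ R PG gamma (pushforward P pr)) => //.
  by move=> E C mE mC; rewrite -generated_indep.
rewrite fubini_tonelli1//.
rewrite ge0_integral_distribution//; last first.
  by move=> w; exact: integral_ge0.
exact: measurable_fun_fubini_tonelli_F.
Qed.

End freezing.

Section gaussian_random_walk.
Context {d : measure_display} {Omega : measurableType d} {R : realType}.
Variables (P : probability Omega R) (s : R) (xi : nat -> Omega -> R).
Hypothesis xi_meas : forall k, measurable_fun setT (xi k).
Hypothesis xi_law : forall k A, measurable A ->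
  P (xi k @^-1` A) = normal_prob 0 s A.
Hypothesis xi_indep : forall k (A : nat -> set R), (forall i, measurable (A i)) ->
  P (\bigcap_(i in `I_k) xi i @^-1` A i) = (\prod_(i < k) P (xi i @^-1` A i))%E.

(** The pi-system generating the past up to time k, in which the independence of
finitely many increments can be read off directly. *)
Definition past_events (k : nat) : set (set Omega) :=
  [set E | exists2 A : nat -> set R, (forall i, measurable (A i)) &
    E = \bigcap_(i in `I_k) xi i @^-1` A i].

Let past_measurable k : past_events k `<=` measurable.
Proof.
move=> _ [A mA ->]; apply: bigcap_measurableType => i _.
by rewrite -[X in measurable X]setTI; exact: xi_meas.
Qed.

Let past_setI k : setI_closed (past_events k).
Proof.
move=> _ _ [A mA ->] [B mB ->]; exists (fun i => A i `&` B i).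
  by move=> i; exact: measurableI.
by rewrite -bigcapI; apply: eq_bigcapr => i _; rewrite preimage_setI.
Qed.

Let past_setT k : past_events k setT.
Proof.
exists (fun=> setT) => //.
by apply/seteqP; split => // w _ i _.
Qed.

Let past_indep k E C : past_events k E -> measurable C ->
  P (E `&` xi k @^-1` C) = (P E * normal_prob 0 s C)%E.
Proof.
move=> [A mA ->] mC; pose B i := if i == k then C else A i.
have mB i : measurable (B i) by rewrite /B; case: ifP.
have BA i : (i < k)%N -> B i = A i by move=> ik; rewrite /B ltn_eqF.
have -> : \bigcap_(i in `I_k) xi i @^-1` A i `&` xi k @^-1` C =
    \bigcap_(i in `I_k.+1) xi i @^-1` B i.
  rewrite (_ : `I_k.+1 = `I_k `|` [set k]); last first.
    apply/seteqP; split => i /=.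
      by rewrite ltnS leq_eqVlt => /orP[/eqP|]; [right|left].
    by move=> [ik|->]; rewrite ltnS// ltnW.
  rewrite bigcap_setU bigcap_set1 /B eqxx; congr (_ `&` _).
  by apply: eq_bigcapr => i /= ik; rewrite ltn_eqF.
rewrite !xi_indep// big_ord_recr/= {2}/B eqxx xi_law//; congr (_ * _)%E.
by apply: eq_bigr => i _; rewrite BA.
Qed.

Let past_xi k i : (i < k)%N ->
  measurable_fun setT (xi i : g_sigma_algebraType (past_events k) -> R).
Proof.
move=> ik _ C mC; rewrite setTI; apply: sub_sigma_algebra.
exists (fun j => if j == i then C else setT); first by move=> j; case: ifP.
apply/seteqP; split => [w wC j _ /=|w /(_ i ik)/=]; last by rewrite eqxx.
by case: ifP => // /eqP ->.
Qed.

Variables (a g : R -> R) (C x : R).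
Hypotheses (ma : measurable_fun setT a) (mg : measurable_fun setT g).
Hypothesis gC : forall y, 0 <= g y <= C.

Let h := s ^+ 2.
Let path w k := euler a x h (xi ^~ w) k.

Let past_path k j : (j <= k)%N ->
  measurable_fun setT ((path ^~ j) : g_sigma_algebraType (past_events k) -> R).
Proof.
elim: j => [|j IH] jk; first exact: measurable_cst.
rewrite /path /=; apply: measurable_funD; last exact: past_xi.
apply: measurable_funD; first exact: IH (ltnW jk).
by apply: measurable_funM => //; apply: measurableT_comp => //; exact: IH (ltnW jk).
Qed.

(** The expression does not depend on j: freezing the first j increments and
averaging over the next one turns the value with n - j - 1 steps to go into the
value with n - j steps to go. The case j = 0 is deterministic. *)
Lemma euler_expectation_partial n j : (j <= n)%N ->
  (\int[P]_w (\prod_(i < j) g (path w i) *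
      euler_value s a g h (n - j) (path w j))%:E =
   (euler_value s a g h n x)%:E)%E.
Proof.
elim: j => [_|j IH jn].
  under eq_integral do rewrite big_ord0 mul1r subn0.
  rewrite -[LHS]/(\int[P]_w (cst (euler_value s a g h n x)%:E) w)%E.
  by rewrite integral_cst// [X in (_ * X)%E](@probability_setT _ _ _ P) mule1.
rewrite -(IH (ltnW jn)).
set m := (n - j.+1)%N; have -> : (n - j)%N = m.+1 by rewrite /m -subSn.
have [mv vC] := euler_value_bounded s h ma mg gC m.
set v := euler_value s a g h m in mv vC *.
pose H (wz : g_sigma_algebraType (past_events j) * measurableTypeR R) : \bar R :=
  (\prod_(i < j.+1) g (path wz.1 i) *
    v (path wz.1 j + a (path wz.1 j) * h + wz.2))%:E.
have mpath i : (i <= j)%N -> measurable_fun setT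
    (fun wz : g_sigma_algebraType (past_events j) * measurableTypeR R => path wz.1 i).
  by move=> ij; apply: (measurableT_comp (past_path ij)).
have mH : measurable_fun setT H.
  apply/measurable_EFinP; apply: measurable_funM.
    apply: measurable_prod => i _; apply: measurableT_comp => //.
    by apply: mpath; rewrite -ltnS.
  apply: measurableT_comp => //; apply: measurable_funD; last exact: measurable_snd.
  apply: measurable_funD; first exact: mpath.
  by apply: measurable_funM => //; apply: measurableT_comp => //; exact: mpath.
have prod_ge0 w k : 0 <= \prod_(i < k) g (path w i).
  by apply: prodr_ge0 => i _; have /andP[] := gC (path w i).
have H0 wz : (0 <= H wz)%E.
  rewrite lee_fin mulr_ge0//.
  by have /andP[] := vC (path wz.1 j + a (path wz.1 j) * h + wz.2).
have := freezing (gamma := normal_prob 0 s) (@past_measurable j) (@past_setI j)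
  (past_setT j) (xi_meas j) (@past_indep j) mH H0.
rewrite /H /= => ->.
apply: eq_integral => w _.
have bv : bounded_measurable (fun z : R => v (path w j + a (path w j) * h + z)).
  exact: (bounded_measurable_shift _ (bounded_measurable_between mv vC)).
transitivity ((\prod_(i < j.+1) g (path w i))%:E *
    \int[normal_prob 0 s]_z (v (path w j + a (path w j) * h + z))%:E)%E.
  rewrite -ge0_integralZl_EFin//; first last.
  - by apply/measurable_EFinP; case: bv.
  - by move=> z _; rewrite lee_fin; have /andP[] := vC (path w j + a (path w j) * h + z).
rewrite -bounded_measurable_EFin_Rintegral//.
by rewrite -EFinM big_ord_recr/= -mulrA.
Qed.

Lemma euler_expectation n :
  (\int[P]_w (\prod_(i < n) g (path w i))%:E = (euler_value s a g h n x)%:E)%E.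
Proof.
rewrite -(euler_expectation_partial (leqnn n)) subnn.
by apply: eq_integral => w _; rewrite /= mulr1.
Qed.

End gaussian_random_walk.

Section brownian_increments.
Context {d : measure_display} {Omega : measurableType d} {R : realType}.
Variables (P : probability Omega R) (W : R -> {RV P >-> R}).
Hypothesis hW : standard_brownian_motion W.
Variables (t : R) (n : nat).
Hypothesis t_gt0 : 0 < t.

Definition brownian_step (k : nat) (w : Omega) : R :=
  mesh_incr (fun r => W r w) t n k.

Lemma measurable_brownian_step k : measurable_fun setT (brownian_step k).
Proof. by apply: measurable_funB. Qed.

Lemma brownian_step_law k A : measurable A ->
  P (brownian_step k @^-1` A) = normal_prob 0 (Num.sqrt (mesh t n)) A.
Proof.
move=> mA; have kk : k%:R * mesh t n < k.+1%:R * mesh t n.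
  by rewrite ltr_pM2r ?mesh_gt0// ltr_nat.
have <- : k.+1%:R * mesh t n - k%:R * mesh t n = mesh t n.
  by rewrite mesh_step addrAC subrr add0r.
exact: (bm_gaussian hW (mesh_pt_ge0 n k (ltW t_gt0)) kk mA).
Qed.

Lemma brownian_step_indep k (A : nat -> set R) : (forall i, measurable (A i)) ->
  P (\bigcap_(i in `I_k) brownian_step i @^-1` A i) =
  (\prod_(i < k) P (brownian_step i @^-1` A i))%E.
Proof.
move=> mA; have ti i : i%:R * mesh t n < i.+1%:R * mesh t n.
  by rewrite ltr_pM2r ?mesh_gt0// ltr_nat.
have t0 : 0 <= 0%:R * mesh t n by rewrite mul0r.
have := bm_indep hW (n := k) (t := fun i => i%:R * mesh t n) t0 ti
  [set: 'I_k]%SET (fun i => mA i).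
rewrite (eq_bigl xpredT); last by move=> i; rewrite inE.
move=> <-; congr (P _); apply/seteqP; split => w wA.
  by move=> i _; exact: (wA i (ltn_ord i)).
by move=> i ik; have := wA (Ordinal ik); apply; rewrite /= inE.
Qed.

End brownian_increments.

(** * Iterated time integrals and moments *)
Section primitive_lipschitz.
Context {R : realType}.
Variables (f : R -> R) (K : R).
Hypothesis cf : continuous f.
Hypothesis fK : forall s, `|f s| <= K.

Let primitive_increment (r s : R) : 0 <= r -> r <= s ->
  `|primitive f s - primitive f r| <= K * (s - r).
Proof.
move=> r0 rs.
have df (z : R) : z \in `]r, s[ -> is_derive z 1 (primitive f) (f z).
  rewrite in_itv/= => /andP[rz _]; apply: is_derive_primitive => //.
  exact: le_lt_trans rz.
have cp : {within `[r, s], continuous (primitive f)}.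
  exact: within_segmentS r0 (lexx s) (continuous_primitive (t := s) cf).
have [c _ ->] := MVT_segment rs df cp.
by rewrite normrM (ger0_norm (_ : 0 <= s - r)) ?subr_ge0// ler_wpM2r ?subr_ge0.
Qed.

(** Time is extended to the real line by s |-> max(0, s), so that continuity can
be used everywhere without one-sided limits at 0. *)
Lemma continuous_primitive_max0 :
  continuous (fun s : R => primitive f (Num.max 0 s)).
Proof.
have K0 : 0 <= K by apply: le_trans (fK 0).
have lip (r s : R) : r <= s ->
    `|primitive f (Num.max 0 s) - primitive f (Num.max 0 r)| <= K * (s - r).
  move=> rs.
  have r0 : 0 <= Num.max 0 r by rewrite le_max lexx.
  have mrs : Num.max 0 r <= Num.max 0 s by rewrite ge_max le_max lexx/= le_max rs orbT.
  apply: le_trans (primitive_increment r0 mrs) _; rewrite ler_wpM2l//.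
  rewrite !maxEle; case: ifP => [s0|/negbT]; case: ifP => [r00|/negbT];
    rewrite -?ltNge; lra.
have K1 : 0 < K + 1 by rewrite ltr_wpDl.
move=> x; apply/cvgrPdist_lt => e e0; near=> y.
have xy : `|x - y| < e / (K + 1).
  near: y; apply/nbhs_ballP; exists (e / (K + 1)).
    by rewrite /= divr_gt0.
  by [].
apply: (@le_lt_trans _ _ (K * `|x - y|)).
  have [xley|/ltW ylex] := leP x y.
    by rewrite distrC (le_trans (lip _ _ xley))// distrC ger0_norm// subr_ge0.
  by rewrite (le_trans (lip _ _ ylex))// ger0_norm// subr_ge0.
apply: (@le_lt_trans _ _ ((K + 1) * `|x - y|)).
  by rewrite ler_wpM2r// lerDl.
by rewrite mulrC -ltr_pdivlMr.
Unshelve. all: by end_near. Qed.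

End primitive_lipschitz.

Section iterated_integral.
Context {d : measure_display} {Omega : measurableType d} {R : realType}.
Variables (P : probability Omega R) (N : set Omega).
Hypothesis mN : measurable N.
Variable V : R -> Omega -> R.
Hypothesis mV : forall s, measurable_fun setT (V s).
Hypothesis cV : forall w, ~ N w -> continuous (V ^~ w).
Variables (f : R -> R) (K : R).
Hypothesis cf : continuous f.
Hypothesis fK : forall x, `|f x| <= K.

Let chi : Omega -> R := \1_(~` N).

Let chi0 w : N w -> chi w = 0.
Proof. by move=> Nw; rewrite /chi indicE memNset//= => /(_ Nw). Qed.

Let chi1 w : ~ N w -> chi w = 1.
Proof. by move=> Nw; rewrite /chi indicE mem_set. Qed.

Let K_ge0 : 0 <= K. Proof. exact: le_trans (fK 0). Qed.

Let cfV w : ~ N w -> continuous (fun s => f (V s w)).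
Proof.
by move=> Nw s; apply: continuous_comp; [exact: cV|exact: cf].
Qed.

Let mfV s : measurable_fun setT (fun w => f (V s w)).
Proof.
apply: measurableT_comp => //; exact: continuous_measurable_fun.
Qed.

(** The integral of f(V_r) over [0, s], set to 0 on the exceptional set N, where
the paths of V may be irregular. *)
Definition occupation (s : R) (w : Omega) : R :=
  chi w * primitive (fun r => f (V r w)) (Num.max 0 s).

Lemma occupation_le s w : `|occupation s w| <= K * Num.max 0 s.
Proof.
have s0 : 0 <= Num.max 0 s by rewrite le_max lexx.
rewrite /occupation; have [Nw|Nw] := pselect (N w).
  by rewrite chi0// mul0r normr0 mulr_ge0.
by rewrite chi1// mul1r primitive_norm_le//; exact: cfV.
Qed.

Lemma bounded_measurable_occupation s : bounded_measurable (occupation s).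
Proof.
have s0 : 0 <= Num.max 0 s by rewrite le_max lexx.
split; last by exists (K * Num.max 0 s) => w; exact: occupation_le.
apply: (measurable_fun_cvg
  (h := fun n w => chi w * riemann_sum (fun r => f (V r w)) (Num.max 0 s) n)).
  move=> n; apply: measurable_funM; first exact/measurable_indic/measurableC.
  by apply: measurable_sum => i; exact: measurable_funM.
move=> w _; rewrite /occupation; have [Nw|Nw] := pselect (N w).
  by rewrite chi0// mul0r; under eq_fun do rewrite mul0r; exact: cvg_cst.
by apply: cvgMr; apply: riemann_sum_primitive => //; exact: cfV.
Qed.

Lemma continuous_occupation w : continuous (occupation ^~ w).
Proof.
move=> s; rewrite /occupation; have [Nw|Nw] := pselect (N w).
  by rewrite chi0//; under eq_fun do rewrite mul0r; exact: cvg_cst.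
by apply: cvgMr; apply: (continuous_primitive_max0 (K := K)) => //; exact: cfV.
Qed.

Section one_step.
Variables (Z : Omega -> R) (m : nat).
Hypothesis bZ : bounded_measurable Z.
Hypothesis ZN : forall w, N w -> Z w = 0.

Let rate (s : R) (w : Omega) : R :=
  Z w * f (V s w) * (occupation s w ^+ m / m`!%:R).

Let bounded_measurable_rate s : bounded_measurable (rate s).
Proof.
apply: bounded_measurableM.
  apply: bounded_measurableM => //; split => //; by exists K.
apply: bounded_measurableM; last exact: bounded_measurable_cst.
by apply: bounded_measurableX; exact: bounded_measurable_occupation.
Qed.

Let continuous_rate w : continuous (rate ^~ w).
Proof.
rewrite /rate; have [Nw|Nw] := pselect (N w).
  rewrite ZN// => s; under eq_fun do rewrite !mul0r; exact: cvg_cst.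
move=> s; apply: cvgM.
  by apply: cvgMr; exact: cfV.
apply: cvgMl.
apply: (@continuous_cvg _ _ _ _ _ _ (fun z : R => z ^+ m) (occupation s w)).
  exact: exprn_continuous.
exact: continuous_occupation.
Qed.

Let rate_mean (s : R) : R := \int[P]_w rate s w.

Let continuous_rate_mean : continuous rate_mean.
Proof.
move=> s; apply/(@cvg_nbhsP _ R^o) => u us.
have [C uC] : exists C, forall n, Num.max 0 (u n) <= C.
  have /cvg_has_ub[C uC] : cvgn (u : R^o^nat) by apply/cvg_ex; exists s.
  exists (Num.max 0 C) => n; rewrite ge_max le_max lexx/= le_max.
  have unC : `|u n| <= C by apply: uC; exists n.
  by rewrite (le_trans (ler_norm _) unC) orbT.
have [_ [D ZD]] := bZ.
have [] := @bounded_convergence _ _ R P (fun n => rate (u n)) (rate s)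
  (D * K * ((K * C) ^+ m / m`!%:R)).
- by move=> n; case: (bounded_measurable_rate (u n)).
- move=> n w; rewrite /rate !normrM; apply: ler_pM; rewrite ?mulr_ge0//.
    by rewrite ler_pM.
  rewrite normfV normr_nat ler_wpM2r// normrX lerXn2r ?nnegrE//.
    by rewrite mulr_ge0// (le_trans _ (uC n))// le_max lexx.
  by rewrite (le_trans (occupation_le _ _))// ler_wpM2l.
- by move=> w; move/(@cvg_nbhsP _ R^o) : (@continuous_rate w s); apply.
by [].
Qed.

(** The exchange of the time integral with the expectation, together with the
fundamental theorem of calculus for the m.+1-th power of the integral. Both
sides are the limit of the expectations of the Riemann sums of [rate], which
involve finitely many times only. *)
Lemma integral_rate_mean (t : R) : 0 < t ->
  \int[lebesgue_measure]_(s in `]0, t[) rate_mean s =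
  \int[P]_w (Z w * (occupation t w ^+ m.+1 / m.+1`!%:R)).
Proof.
move=> t0.
have -> : \int[lebesgue_measure]_(s in `]0, t[) rate_mean s =
    primitive rate_mean t.
  have ic : lebesgue_measure.-integrable `[0, t] (EFin \o rate_mean).
    exact: continuous_integrable_segment continuous_rate_mean.
  rewrite Rintegral_itv_obnd_cbnd; last first.
    by apply: integrableS ic => //; apply: subset_itv; rewrite bnd_simp.
  rewrite Rintegral_itv_bndo_bndc//.
  by apply: integrableS ic => //; apply: subset_itv; rewrite bnd_simp.
have lim1 := riemann_sum_primitive (ltW t0) continuous_rate_mean.
pose G w := Z w * (occupation t w ^+ m.+1 / m.+1`!%:R).
have pathwise w : riemann_sum (rate ^~ w) t n @[n --> \oo] --> G w.
  rewrite /G; have [Nw|Nw] := pselect (N w).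
    rewrite ZN// mul0r /riemann_sum.
    apply: cvg_near_cst; apply: nearW => k.
    by rewrite big1// => i _; rewrite /rate ZN// !mul0r.
  pose F := primitive (fun r => f (V r w)).
  pose Gp (s : R) := Z w * (F s ^+ m.+1 / m.+1`!%:R).
  have -> : Z w * (occupation t w ^+ m.+1 / m.+1`!%:R) = Gp t - Gp 0.
    rewrite /Gp /F primitive0 expr0n/= mul0r mulr0 subr0.
    by rewrite /occupation chi1// mul1r max_r// ltW.
  apply: riemann_sum_cvg; first exact: ltW.
  - exact: continuous_rate.
  - move=> s; apply: cvgMr; apply: cvgMl.
    apply: (@continuous_cvg _ _ _ _ _ _ (fun z : R => z ^+ m.+1) (F s)).
      exact: exprn_continuous.
    by apply: continuous_primitive; exact: cfV.
  - move=> s s0; have dF := is_derive_primitive (@cfV w Nw) s0.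
    have dX : is_derive s 1 (fun z => F z ^+ m.+1)
        ((m.+1%:R * F s ^+ m) * f (V s w)).
      exact: is_derive_pow.
    apply: is_derive_eq (is_derive_mul (is_derive_cst (Z w) s 1)
      (is_derive_mul dX (is_derive_cst (m.+1`!%:R^-1 : R) s 1))) _.
    rewrite /rate /occupation chi1// mul1r max_r ?(ltW s0)// -/F factS natrM /=.
    have m1 : m.+1%:R != 0 :> R by rewrite pnatr_eq0.
    have mf : m`!%:R != 0 :> R by rewrite pnatr_eq0 -lt0n fact_gt0.
    move: (m.+1%:R) (m`!%:R : R) m1 mf => u v u0 v0.
    by field; rewrite ?u0 ?v0.
have [_ [D ZD]] := bZ.
have [] := @bounded_convergence _ _ R P (fun n w => riemann_sum (rate ^~ w) t n) G
  (t * (D * K * ((K * t) ^+ m / m`!%:R))).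
- move=> n; case: (bounded_measurable_sum (index_enum 'I_n.+1)
    (fun i : 'I_n.+1 => bounded_measurableM
       (bounded_measurable_rate (i%:R * mesh t n))
       (bounded_measurable_cst (mesh t n)))) => //.
- move=> n w; rewrite /riemann_sum (le_trans (ler_norm_sum _ _ _))//.
  rewrite -[X in X * _](mesh_total t n) -mulrA mulr_natl.
  rewrite -[X in _ *+ X]card_ord -sumr_const.
  apply: ler_sum => i _; rewrite normrM (ger0_norm (mesh_ge0 n (ltW t0))) mulrC.
  rewrite ler_wpM2l ?mesh_ge0 ?(ltW t0)//.
  have it : i%:R * mesh t n <= t by rewrite mesh_pt_le ?(ltW t0)// ltnW.
  have i0 : 0 <= i%:R * mesh t n by rewrite mesh_pt_ge0 ?(ltW t0).
  rewrite /rate !normrM; apply: ler_pM; rewrite ?mulr_ge0//.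
    by rewrite ler_pM.
  rewrite normfV normr_nat ler_wpM2r// normrX lerXn2r ?nnegrE//.
    by rewrite mulr_ge0// ltW.
  by rewrite (le_trans (occupation_le _ _))// ler_wpM2l// max_r.
- exact: pathwise.
move=> _ lim2.
have lim1' : \int[P]_w riemann_sum (rate ^~ w) t n @[n --> \oo] -->
    primitive rate_mean t.
  apply: cvg_trans lim1; apply: near_eq_cvg; apply: nearW => n.
  rewrite /riemann_sum bounded_measurable_Rintegral_sum; last first.
    by move=> i; apply: bounded_measurableM => //; exact: bounded_measurable_cst.
  apply: eq_bigr => i _; rewrite [RHS]RintegralZr//.
  exact: bounded_measurable_integrable.
exact: cvg_unique lim1' lim2.
Qed.

End one_step.

Lemma eq_simplex_integral n (t : R) (F G : seq R -> R) :
  (forall l, all (fun s => 0 < s) l -> F l = G l) ->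
  simplex_integral n t F = simplex_integral n t G.
Proof.
elim: n t F G => [|n IH] t F G FG /=; first exact: FG.
apply: eq_Rintegral => s; rewrite inE/= in_itv/= => /andP[s0 _].
by apply: IH => l l0; apply: FG; rewrite all_rcons s0.
Qed.

(** Time-ordered products integrate to the n-th power over n!. In the induction
the outermost time s contributes the factor f(V_s), which joins the weight Z;
this is why the statement carries a weight. *)
Lemma simplex_integral_power n (t : R) (Z : Omega -> R) : 0 < t ->
  bounded_measurable Z -> (forall w, N w -> Z w = 0) ->
  simplex_integral n t (fun l => \int[P]_w (Z w * \prod_(s <- l) f (V s w))) =
  \int[P]_w (Z w * (occupation t w ^+ n / n`!%:R)).
Proof.
elim: n t Z => [|n IH] t Z t0 bZ ZN.
  by apply: eq_Rintegral => w _; rewrite /= big_nil expr0 fact0 divr1.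
rewrite /= -integral_rate_mean//; apply: eq_Rintegral => s.
rewrite inE/= in_itv/= => /andP[s0 _].
have bZf : bounded_measurable (fun w => Z w * f (V s w)).
  by apply: bounded_measurableM => //; split => //; exists K.
rewrite -IH//; last by move=> w Nw; rewrite ZN// mul0r.
congr (simplex_integral n s _); apply/funext => l.
apply: eq_Rintegral => w _.
by rewrite -cats1 big_cat/= big_seq1 mulrA mulrAC.
Qed.

End iterated_integral.

(** * Exponential moments from bounds on the moments *)
Section exponential_moment.
Context {d : measure_display} {Omega : measurableType d} {R : realType}.
Variable P : probability Omega R.

Lemma series_exp_coeff_le_expR (y : R) n : 0 <= y ->
  \sum_(k < n) y ^+ k / k`!%:R <= expR y.
Proof.
move=> y0; have cv := is_cvg_series_exp_coeff y.
have nd : nondecreasing_seq (series (exp_coeff y)).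
  apply/nondecreasing_seqP => k; rewrite seriesSr lerDl.
  exact: exp_coeff_ge0.
have := nondecreasing_cvgn_le nd cv n.
by rewrite [X in X <= _]/series/= big_mkord.
Qed.

Lemma norm_series_exp_coeff_le (y c : R) n : `|y| <= c ->
  `|\sum_(k < n) y ^+ k / k`!%:R| <= expR c.
Proof.
move=> yc; apply: (le_trans (ler_norm_sum _ _ _)).
apply: le_trans (_ : expR `|y| <= _); last by rewrite ler_expR.
apply: le_trans (series_exp_coeff_le_expR n (normr_ge0 y)).
by apply: ler_sum => k _; rewrite normrM normrX normfV normr_nat.
Qed.

(** The terms of index 2 k and 2 k + 1 share the factorial k!, so that together
they make (1 + a) (a^2)^k / k!. *)
Lemma half_factorial_series_le (a : R) n : 0 <= a ->
  \sum_(k < n) a ^+ k / (k./2)`!%:R <= (1 + a) * expR (a ^+ 2).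
Proof.
move=> a0.
have term0 k : 0 <= a ^+ k / (k./2)`!%:R by rewrite divr_ge0// exprn_ge0.
have even m : \sum_(k < m.*2) a ^+ k / (k./2)`!%:R =
    (1 + a) * \sum_(k < m) (a ^+ 2) ^+ k / k`!%:R.
  elim: m => [|m IH]; first by rewrite !big_ord0 mulr0.
  rewrite doubleS !big_ord_recr/= IH uphalf_double doubleK mulrDr -addrA.
  congr (_ + _); rewrite -exprM mul2n exprS; ring.
apply: (@le_trans _ _ (\sum_(k < n.*2) a ^+ k / (k./2)`!%:R)).
  rewrite -addnn big_split_ord/= lerDl; apply: sumr_ge0 => k _.
  exact: term0.
rewrite even ler_wpM2l ?addr_ge0//.
exact/series_exp_coeff_le_expR/sqr_ge0.
Qed.

Lemma exponential_moment_le (Z Y : Omega -> R) (c A : R) :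
  bounded_measurable Z -> bounded_measurable Y -> 0 <= c -> 0 <= A ->
  (forall n, \int[P]_w (Z w * (Y w ^+ n / n`!%:R)) <= A ^+ n / (n./2)`!%:R) ->
  \int[P]_w (Z w * expR (c * Y w)) <= (1 + c * A) * expR ((c * A) ^+ 2).
Proof.
move=> bZ bY c0 A0 mom.
have [mZ [D ZD]] := bZ; have [mY [L YL]] := bY.
pose term n w := c ^+ n * (Z w * (Y w ^+ n / n`!%:R)).
have bt n : bounded_measurable (fun w => Z w * (Y w ^+ n / n`!%:R)).
  apply: bounded_measurableM => //; apply: bounded_measurableM.
    exact: bounded_measurableX.
  exact: bounded_measurable_cst.
have bterm n : bounded_measurable (term n).
  by apply: bounded_measurableM => //; exact: bounded_measurable_cst.
have partialE n w : \sum_(k < n) term k w =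
    Z w * \sum_(k < n) (c * Y w) ^+ k / k`!%:R.
  by rewrite mulr_sumr; apply: eq_bigr => k _; rewrite /term exprMn; ring.
have [] := @bounded_convergence _ _ R P (fun n w => \sum_(k < n) term k w)
  (fun w => Z w * expR (c * Y w)) (D * expR (c * L)).
- by move=> n; case: (bounded_measurable_sum (index_enum 'I_n)
    (fun i : 'I_n => bterm i)).
- move=> n w; rewrite partialE normrM ler_pM// norm_series_exp_coeff_le//.
  by rewrite normrM (ger0_norm c0) ler_wpM2l.
- move=> w; under eq_fun do rewrite partialE.
  have cv : series (exp_coeff (c * Y w)) n @[n --> \oo] --> expR (c * Y w).
    exact: is_cvg_series_exp_coeff.
  by rewrite seriesEord in cv; exact: cvgMr cv.
move=> _ lim; apply: (cvgr_to_le lim); apply: nearW => n.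
rewrite bounded_measurable_Rintegral_sum; last by move=> i; exact: bterm.
apply: le_trans (half_factorial_series_le n (mulr_ge0 c0 A0)).
apply: ler_sum => k _; rewrite bounded_measurable_RintegralZl//.
by rewrite exprMn -mulrA ler_wpM2l// exprn_ge0.
Qed.

End exponential_moment.

Section nonmeasurable_expectation.
Context {d : measure_display} {Omega : measurableType d} {R : realType}.
Variable P : probability Omega R.

Lemma fine_expectation (f : Omega -> R) : fine 'E_P[f] = \int[P]_w f w.
Proof. by rewrite unlock. Qed.

(** Meant for an f, such as the derivative of the flow, that is controlled only
outside a null set and not known to be measurable. The integral of f is a
supremum over the simple functions below f, hence monotone, and f lies
everywhere below the measurable function equal to Y off N and to +oo on N. *)
Lemma expectation_le_off_null (N : set Omega) (f Y : Omega -> R) :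
  measurable N -> P N = 0%E -> (forall w, 0 <= f w) ->
  bounded_measurable Y -> (forall w, 0 <= Y w) ->
  (forall w, ~ N w -> f w <= Y w) ->
  ('E_P[f] <= (\int[P]_w Y w)%:E)%E.
Proof.
move=> mN PN0 f0 bY Y0 fY; rewrite unlock bounded_measurable_EFin_Rintegral//.
pose g w := if w \in N then +oo%E else (Y w)%:E.
have g0 w : (0 <= g w)%E by rewrite /g; case: ifP => // _; rewrite lee_fin.
have mg : measurable_fun setT g.
  apply: measurable_fun_ifT => //.
    apply: (measurable_fun_bool true); rewrite setTI.
    rewrite (_ : _ @^-1` _ = N)//; apply/seteqP; split => w /=.
      by move/set_mem.
    by move/mem_set.
  by apply/measurable_EFinP; case: bY.
apply: (@le_trans _ _ (\int[P]_w g w)%E).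
  rewrite ge0_integralTE; last by move=> w; rewrite lee_fin.
  rewrite ge0_integralTE//=; apply: le_ereal_sup => _ [h hf <-]; exists h => // w.
  rewrite /g; case: ifPn => [_|]; first exact: leey.
  by rewrite notin_setE => /fY fYw; rewrite (le_trans (hf w))// lee_fin.
rewrite (@ge0_ae_eq_integral _ _ _ P setT g (fun w => (Y w)%:E))//.
- by apply/measurable_EFinP; case: bY.
- by move=> w _; rewrite lee_fin.
exists N; split => // w /= ngY; apply: contrapT => Nw; apply: ngY => _.
by rewrite /g memNset.
Qed.

Lemma Rintegral_off_null (N : set Omega) (f : Omega -> R) :
  measurable N -> P N = 0%E -> measurable_fun setT f ->
  \int[P]_w f w = \int[P]_w (\1_(~` N) w * f w).
Proof.
move=> mN PN0 mf; congr fine; apply: ae_eq_integral => //.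
- exact/measurable_EFinP.
- apply/measurable_EFinP; apply: measurable_funM => //.
  exact/measurable_indic/measurableC.
exists N; split => // w /= nE; apply: contrapT => Nw; apply: nE => _.
by rewrite indicE mem_set// mul1r.
Qed.

End nonmeasurable_expectation.

(** * The estimate for the flow *)
Section path_extension.
Context {R : realType}.

Lemma continuous_max0 (phi : R -> R) : {within `[0, +oo[, continuous phi} ->
  continuous (fun s : R => phi (Num.max 0 s)).
Proof.
move=> /subspace_continuousP cphi x.
have mx0 : `[0, +oo[%classic (Num.max 0 x).
  by rewrite /= in_itv/= andbT le_max lexx.
have cmax : {for x, continuous (fun s : R => Num.max 0 s)}.
  apply: (@continuous_max R R (cst 0) id x); [exact: cvg_cst|exact: cvg_id].
have cw : Num.max 0 s @[s --> x] --> within `[0, +oo[ (nbhs (Num.max 0 x)).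
  move=> U wU; have : \forall s \near x,
      `[0, +oo[%classic (Num.max 0 s) -> U (Num.max 0 s) := cmax _ wU.
  apply: (@filterS _ (nbhs x)) => s h; apply: h.
  have s0 : 0 <= Num.max 0 (s : R) by rewrite le_max lexx.
  by rewrite /= in_itv/= andbT.
exact: (cvg_comp _ _ cw (cphi _ mx0)).
Qed.

End path_extension.

Section bounded_drift.
Context {R : realType}.
Variable b : R -> R.
Hypothesis hb : Cb1 b.

Lemma Cb1_is_derive (x : R) : is_derive x 1 b (derive1 b x).
Proof.
case: hb => _ db _ _; apply: DeriveDef; first exact: db.
by rewrite derive1E.
Qed.

Lemma Cb1_derivative_bound : exists K, forall x, `|derive1 b x| <= K.
Proof.
case: hb => _ _ _ [M [_ bM]]; exists (M + 1) => x.
by apply: (bM (M + 1)) => //; rewrite ltrDl.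
Qed.

Lemma Cb1_le_sup_norm (x : R) : `|b x| <= sup_norm b.
Proof.
case: hb => [[M [_ bM]] _ _ _]; apply: sup_upper_bound; last by exists x.
split; first by exists `|b x|; exists x.
by exists (M + 1) => _ [y _ <-]; apply: (bM (M + 1)) => //; rewrite ltrDl.
Qed.

Lemma is_derive_translate (x z : R) :
  is_derive z 1 (fun z => b (x + z)) (derive1 b (x + z)).
Proof.
have db := Cb1_is_derive (x + z).
have dt : is_derive z 1 (fun z : R => x + z) (1 : R).
  apply: is_derive_eq (is_deriveD (is_derive_cst x z 1) (is_derive_id z 1)) _.
  by rewrite add0r.
rewrite -[X in is_derive _ _ _ X]mulr1.
exact: (@is_derive1_comp R b (fun z => x + z) z _ _ db dt).
Qed.

Lemma derive1_translate (x : R) :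
  derive1 (fun z => b (x + z)) = (fun z => derive1 b (x + z)).
Proof.
apply/funext => z; rewrite derive1E.
exact: (@derive_val _ _ _ _ _ _ _ (is_derive_translate x z)).
Qed.

Lemma Cb1_translate (x : R) : Cb1 (fun z => b (x + z)).
Proof.
have [M [M0 bM]] : bounded_fun b by case: hb.
have [L [L0 dbL]] : bounded_fun (derive1 b) by case: hb.
have cdb : continuous (derive1 b) by case: hb.
split.
- by exists M; split => // k Mk z _; exact: (bM k Mk (x + z)).
- by move=> z; have [] := is_derive_translate x z.
- rewrite derive1_translate => z; apply: continuous_comp; last exact: cdb.
  by apply: cvgD; [exact: cvg_cst|exact: cvg_id].
- rewrite derive1_translate; exists L; split => // k Lk z _.
  exact: (dbL k Lk (x + z)).
Qed.

Lemma sup_norm_translate (x : R) : sup_norm (fun z => b (x + z)) = sup_norm b.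
Proof.
congr sup; apply/seteqP; split => _ [y _ <-].
  by exists (x + y).
by exists (y - x) => //; rewrite subrKC.
Qed.

End bounded_drift.

Lemma cvg_square_le {R : realType} (u v : nat -> R) (l m c : R) :
  u n @[n --> \oo] --> l -> v n @[n --> \oo] --> m ->
  (forall n, u n ^+ 2 <= c * v n) -> l ^+ 2 <= c * m.
Proof.
move=> ul vm uv; rewrite expr2.
have ull : u n * u n @[n --> \oo] --> l * l by apply: cvgM.
have cvm : c * v n @[n --> \oo] --> c * m by apply: cvgM => //; exact: cvg_cst.
by apply: (ler_cvg_to ull cvm); apply: nearW => n; rewrite -expr2.
Qed.

Section main_estimate.
Context {d : measure_display} {Omega : measurableType d} {R : realType}.
Variables (P : probability Omega R) (W : R -> {RV P >-> R}).
Hypothesis hW : standard_brownian_motion W.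
Variable b : R -> R.
Hypothesis hb : Cb1 b.
Variable X : R -> R -> {RV P >-> R}.
Hypothesis hX : sde_flow b W X.

Let db : R -> R := derive1 b.
Let B : R := sup_norm b.

Let db_cont : continuous db. Proof. by case: hb. Qed.

Let mb : measurable_fun setT b.
Proof.
apply: continuous_measurable_fun.
exact: (drift_continuous (Cb1_is_derive hb)).
Qed.

Let mdb : measurable_fun setT db.
Proof. exact: continuous_measurable_fun. Qed.

Definition noise (s : R) (w : Omega) : R := W (Num.max 0 s) w.
Definition flow (w : Omega) (x s : R) : R := X (Num.max 0 s) x w.

(** One null set outside which the path of the noise and the solutions from all
starting points behave well; times are extended by max(0, s). *)
Lemma exceptional_null_set : exists N : set Omega,
  [/\ measurable N, P N = 0%E & forall w, ~ N w ->
    [/\ W 0 w = 0, continuous (noise ^~ w), forall x, continuous (flow w x) &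
      forall x s : R, 0 <= s ->
        flow w x s = x + noise s w + primitive (b \o flow w x) s]].
Proof.
have [N1 [mN1 PN1 sN1]] := bm_start hW.
have [N2 [mN2 PN2 sN2]] := bm_continuous hW.
have [N3 [mN3 PN3 sN3]] := hX.
exists (N1 `|` N2 `|` N3); split.
- by apply: measurableU => //; exact: measurableU.
- by rewrite null_set_setU// ?null_set_setU//; exact: measurableU.
move=> w Nw.
have W0 : W 0 w = 0 by apply: contrapT => h; apply: Nw; left; left; exact: sN1.
have Wc : {within `[0, +oo[, continuous (fun t => W t w)}.
  by apply: contrapT => h; apply: Nw; left; right; exact: sN2.
have Xe : forall x : R, {within `[0, +oo[, continuous (fun t => X t x w)} /\
    forall t, 0 <= t -> X t x w =
      x + W t w + \int[lebesgue_measure]_(s in `[0, t]) b (X s x w).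
  by apply: contrapT => h; apply: Nw; right; exact: sN3.
split => //.
- exact: continuous_max0 Wc.
- by move=> x; exact: continuous_max0 (Xe x).1.
move=> x s s0; rewrite /flow /noise max_r// (Xe x).2//; congr (_ + _).
apply: eq_Rintegral => r; rewrite inE/= in_itv/= => /andP[r0 _].
by rewrite max_r.
Qed.

Let step_weight (p t : R) n (y : R) : R := expR (p * db y * mesh t n).

(** The weight exp(p b' h) makes the product along the scheme the exponential of
a Riemann-type sum, and the n.+1 factors exp(h B^2) multiply to exp(t B^2). *)
Lemma discrete_girsanov (p t x : R) n : 0 <= p -> 0 < t ->
  (\int[P]_w expR (p * \sum_(k < n.+1)
     db (euler b x (mesh t n) (mesh_incr (W ^~ w) t n) k) * mesh t n)) ^+ 2 <=
  expR (t * B ^+ 2) * \int[P]_w expR (2 * p * \sum_(k < n.+1)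
     db (euler (cst 0) x (mesh t n) (mesh_incr (W ^~ w) t n) k) * mesh t n).
Proof.
move=> p0 t0; have h0 := mesh_gt0 n t0.
set s := Num.sqrt (mesh t n).
have s0 : 0 < s by rewrite sqrtr_gt0.
have s2 : s ^+ 2 = mesh t n by rewrite sqr_sqrtr// ltW.
have [K dbK] := Cb1_derivative_bound hb.
pose C := expR (p * K * mesh t n).
have mg : measurable_fun setT (step_weight p t n).
  apply: measurableT_comp => //; apply: measurable_funM => //.
  exact: measurable_funM.
have gC y : 0 <= step_weight p t n y <= C.
  rewrite expR_ge0/= ler_expR ler_wpM2r ?(ltW h0)// ler_wpM2l//.
  exact: le_trans (ler_norm _) (dbK y).
have mg2 : measurable_fun setT (fun y => step_weight p t n y ^+ 2).
  exact: measurable_funX.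
have g2C y : 0 <= step_weight p t n y ^+ 2 <= C ^+ 2.
  by have /andP[g0 g1] := gC y; rewrite sqr_ge0 lerXn2r// nnegrE (le_trans g0).
have m0 : measurable_fun setT (cst 0 : R -> R) by [].
have law (a g : R -> R) (D : R)
    (ma : measurable_fun setT a) (mg' : measurable_fun setT g)
    (gD : forall y : R, 0 <= g y <= D) :
  \int[P]_w \prod_(k < n.+1) g (euler a x (mesh t n) (mesh_incr (W ^~ w) t n) k) =
    euler_value s a g (mesh t n) n.+1 x.
  have := euler_expectation (measurable_brownian_step W t n)
    (brownian_step_law hW n t0) (brownian_step_indep hW n t0) x ma mg' gD n.+1.
  by rewrite s2 => E; rewrite /Rintegral E.
have E1 : euler_value s b (step_weight p t n) (mesh t n) n.+1 x =
    \int[P]_w expR (p * \sum_(k < n.+1)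
      db (euler b x (mesh t n) (mesh_incr (W ^~ w) t n) k) * mesh t n).
  rewrite -(law _ _ _ mb mg gC).
  apply: eq_Rintegral => w _.
  rewrite mulr_sumr expR_sum; apply: eq_bigr => k _.
  by rewrite /step_weight mulrA.
have E2 : euler_value s (cst 0) (fun y => step_weight p t n y ^+ 2) (mesh t n) n.+1 x =
    \int[P]_w expR (2 * p * \sum_(k < n.+1)
      db (euler (cst 0) x (mesh t n) (mesh_incr (W ^~ w) t n) k) * mesh t n).
  rewrite -(law _ _ _ m0 mg2 g2C).
  apply: eq_Rintegral => w _.
  rewrite mulr_sumr expR_sum; apply: eq_bigr => k _.
  rewrite /step_weight -expRM_natl; congr expR.
  ring.
have := euler_value_girsanov s0 n.+1 x mb mg gC (Cb1_le_sup_norm hb).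
rewrite s2 E1 E2 [X in expR X](_ : _ = t * B ^+ 2)//.
by rewrite mulrCA mesh_total mulrC.
Qed.

Section limits.
Variable N : set Omega.
Hypothesis mN : measurable N.
Hypothesis PN0 : P N = 0%E.
Hypothesis N_good : forall w, ~ N w ->
  [/\ W 0 w = 0, continuous (noise ^~ w), forall x, continuous (flow w x) &
      forall x s : R, 0 <= s ->
        flow w x s = x + noise s w + primitive (b \o flow w x) s].

Let chi : Omega -> R := \1_(~` N).

Let chi0 w : N w -> chi w = 0.
Proof. by move=> Nw; rewrite /chi indicE memNset//= => /(_ Nw). Qed.

Let chi1 w : ~ N w -> chi w = 1.
Proof. by move=> Nw; rewrite /chi indicE mem_set. Qed.

Let bchi : bounded_measurable chi.
Proof.
split; first exact/measurable_indic/measurableC.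
exists 1 => w; have [Nw|Nw] := pselect (N w).
  by rewrite chi0// normr0.
by rewrite chi1// normr1.
Qed.

Let mesh_incr_noise w t n k : 0 <= t ->
  mesh_incr (W ^~ w) t n k = mesh_incr (noise ^~ w) t n k.
Proof. by move=> t0; rewrite /mesh_incr /noise !max_r// mesh_pt_ge0. Qed.

Let euler_noise a x w t n k : 0 <= t ->
  euler a x (mesh t n) (mesh_incr (W ^~ w) t n) k =
  euler a x (mesh t n) (mesh_incr (noise ^~ w) t n) k.
Proof.
move=> t0; elim: k => [|k IH] //=.
by rewrite IH mesh_incr_noise.
Qed.

Let measurable_euler a x t n k : measurable_fun setT a ->
  measurable_fun setT (fun w => euler a x (mesh t n) (mesh_incr (W ^~ w) t n) k).
Proof.
move=> ma; elim: k => [|k IH] /=; first exact: measurable_cst.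
apply: measurable_funD; last exact: measurable_funB.
apply: measurable_funD => //; apply: measurable_funM => //.
exact: measurableT_comp.
Qed.

(** Bounded convergence for the exponentials, the exceptional set being removed
by the weight chi. *)
Let exponential_limit (a : R -> R) (q t x : R) (L : Omega -> R) :
  measurable_fun setT a -> 0 <= t ->
  (forall w, ~ N w -> \sum_(k < n.+1)
     db (euler a x (mesh t n) (mesh_incr (W ^~ w) t n) k) * mesh t n
     @[n --> \oo] --> L w) ->
  bounded_measurable (fun w => chi w * expR (q * L w)) /\
  \int[P]_w expR (q * \sum_(k < n.+1)
     db (euler a x (mesh t n) (mesh_incr (W ^~ w) t n) k) * mesh t n)
  @[n --> \oo] --> \int[P]_w (chi w * expR (q * L w)).
Proof.
move=> ma t0 cvL; have [K dbK] := Cb1_derivative_bound hb.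
pose S n w := \sum_(k < n.+1)
  db (euler a x (mesh t n) (mesh_incr (W ^~ w) t n) k) * mesh t n.
have mS n : measurable_fun setT (fun w => expR (q * S n w)).
  apply: measurableT_comp => //; apply: measurable_funM => //.
  apply: measurable_sum => k; apply: measurable_funM => //.
  by apply: measurableT_comp => //; exact: measurable_euler.
have S_le n w : `|S n w| <= K * t.
  apply: (le_trans (ler_norm_sum _ _ _)).
  rewrite -[X in _ * X](mesh_total t n) mulrCA mulr_natl.
  rewrite -[X in _ *+ X]card_ord -sumr_const.
  apply: ler_sum => k _; rewrite normrM (ger0_norm (mesh_ge0 n t0)).
  by rewrite ler_wpM2r ?mesh_ge0.
have [] := @bounded_convergence _ _ R P
  (fun n w => chi w * expR (q * S n w)) (fun w => chi w * expR (q * L w))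
  (expR (`|q| * (K * t))).
- by move=> n; apply: measurable_funM => //; case: bchi.
- move=> n w; have [Nw|Nw] := pselect (N w).
    by rewrite chi0// mul0r normr0 expR_ge0.
  rewrite chi1// mul1r ger0_norm ?expR_ge0// ler_expR.
  by rewrite (le_trans (ler_norm _))// normrM ler_wpM2l.
- move=> w; have [Nw|Nw] := pselect (N w).
    by rewrite chi0// mul0r; apply: cvg_near_cst; apply: nearW => n; rewrite mul0r.
  apply: cvgMr; apply: (@continuous_cvg _ _ _ _ _ _ expR (q * L w)).
    exact: continuous_expR.
  by apply: cvgMr; exact: cvL.
move=> bl lim; split => //; apply: cvg_trans lim.
apply: near_eq_cvg; apply: nearW => n.
exact: (esym (Rintegral_off_null mN PN0 (mS n))).
Qed.

Lemma girsanov_estimate (p t x : R) : 0 <= p -> 0 < t ->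
  [/\ bounded_measurable
        (fun w => chi w * expR (p * primitive (db \o flow w x) t)) &
  (\int[P]_w (chi w * expR (p * primitive (db \o flow w x) t))) ^+ 2 <=
  expR (t * B ^+ 2) * \int[P]_w (chi w *
    expR (2 * p * primitive (fun s => db (x + noise s w)) t))].
Proof.
move=> p0 t0; have [K dbK] := Cb1_derivative_bound hb.
have cv1 w : ~ N w -> \sum_(k < n.+1)
    db (euler b x (mesh t n) (mesh_incr (W ^~ w) t n) k) * mesh t n
    @[n --> \oo] --> primitive (db \o flow w x) t.
  move=> Nw; have [W0 cW cX XE] := N_good Nw.
  under eq_fun do under eq_bigr do rewrite (euler_noise _ _ _ _ _ (ltW t0)).
  apply: (euler_sum_cvg (Cb1_is_derive hb) dbK (ltW t0)) => //.
    by rewrite /noise max_l.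
  exact: XE.
have cv2 w : ~ N w -> \sum_(k < n.+1)
    db (euler (cst 0) x (mesh t n) (mesh_incr (W ^~ w) t n) k) * mesh t n
    @[n --> \oo] --> primitive (fun s => db (x + noise s w)) t.
  move=> Nw; have [W0 cW cX XE] := N_good Nw.
  have noise0 : noise 0 w = 0 by rewrite /noise max_l.
  under eq_fun do under eq_bigr do
    rewrite (euler_noise _ _ _ _ _ (ltW t0)) euler_no_drift//.
  apply: riemann_sum_primitive; first exact: ltW.
  move=> s; apply: continuous_comp; last exact: db_cont.
  by apply: cvgD; [exact: cvg_cst|exact: cW].
have [bl lim1] := exponential_limit p mb (ltW t0) cv1.
have [_ lim2] := exponential_limit (2 * p) (measurable_cst _) (ltW t0) cv2.
split; first exact: bl.
exact: (cvg_square_le lim1 lim2 (fun n => discrete_girsanov x n p0 t0)).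
Qed.

(** Davie's bound is applied to the translate z |-> b(x + z), which has the same
supremum norm as b. *)
Lemma brownian_exponential_moment (M c t x : R) : davie_constant W M ->
  0 <= c -> 0 < t ->
  \int[P]_w (chi w * expR (c * primitive (fun s => db (x + noise s w)) t)) <=
  (1 + c * (M * B * Num.sqrt t)) * expR ((c * (M * B * Num.sqrt t)) ^+ 2).
Proof.
move=> [M0 davie] c0 t0; have [K dbK] := Cb1_derivative_bound hb.
pose f z := db (x + z).
have cf : continuous f.
  move=> z; apply: continuous_comp; last exact: db_cont.
  by apply: cvgD; [exact: cvg_cst|exact: cvg_id].
have fK z : `|f z| <= K by exact: dbK.
have mV s : measurable_fun setT (noise s) by [].
have cV w : ~ N w -> continuous (noise ^~ w) by case/N_good.
have B0 : 0 <= B by apply: le_trans (Cb1_le_sup_norm hb 0).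
have -> : \int[P]_w (chi w * expR (c * primitive (fun s => db (x + noise s w)) t)) =
    \int[P]_w (chi w * expR (c * occupation N noise f t w)).
  apply: eq_Rintegral => w _; have [Nw|Nw] := pselect (N w).
    by rewrite chi0// !mul0r.
  by rewrite /occupation -/chi chi1// !mul1r max_r ?(ltW t0).
apply: exponential_moment_le => //.
- exact: (bounded_measurable_occupation mN mV cV cf fK).
- by rewrite !mulr_ge0 ?sqrtr_ge0 ?(ltW M0).
move=> n.
rewrite -(simplex_integral_power P mN mV cV cf fK n t0 bchi)//.
have := davie _ (Cb1_translate hb x) n t t0.
rewrite /davie_integral sup_norm_translate (derive1_translate hb) -/B.
move=> /(le_trans (ler_norm _)) h.
rewrite (@eq_simplex_integral _ n t _ (fun l =>
  fine 'E_P[fun w => (\prod_(s <- l) derive1 b (x + W s w))%R])); last first.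
  move=> l l0; rewrite fine_expectation [RHS](Rintegral_off_null mN PN0); last first.
    apply: measurable_prod => s _; apply: measurableT_comp => //.
    exact: measurable_funD.
  apply: eq_Rintegral => w _; congr (_ * _).
  apply: eq_big_seq => s sl; rewrite /f /noise max_r//.
  by have /allP/(_ s sl)/ltW := l0.
apply: (le_trans h).
have -> : t `^ (n%:R / 2) = Num.sqrt t ^+ n.
  rewrite -(powR12_sqrt (ltW t0)) -powR_mulrn ?powR_ge0//.
  by rewrite -powRrM mulrC.
rewrite !exprMn le_eqVlt; apply/orP; left; apply/eqP; ring.
Qed.

End limits.

End main_estimate.

Theorem theorem6p2 (d : measure_display) (Omega : measurableType d)
    (R : realType) (P : probability Omega R)
    (W : R -> {RV P >-> R}) (hW : standard_brownian_motion W)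
    (T : R) (hT : 0 < T) (b : R -> R) (hb : Cb1 b)
    (X : R -> R -> {RV P >-> R}) (hX : sde_flow b W X)
    (p : R) (hp : 1 <= p) (M : R) (hM : davie_constant W M)
    (t : R) (ht : 0 <= t <= T) (x : R) :
  ('E_P[fun w => (`|derive1 (fun y => X t y w) x| `^ p)%R] <=
   ((1 + 2 * p * M * Num.sqrt t * sup_norm b) *
    expR ((1 + 2 * p ^+ 2 * M ^+ 2) * T * sup_norm b ^+ 2))%:E)%E.
Proof.
have /andP[t0 tT] := ht.
have p0 : 0 <= p by exact: le_trans hp.
have M0 : 0 < M by case: hM.
have B0 : 0 <= sup_norm b by apply: le_trans (Cb1_le_sup_norm hb 0).
have [K dbK] := Cb1_derivative_bound hb.
have db_cont : continuous (derive1 b) by case: hb.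
have [N [mN PN0 N_good]] := exceptional_null_set hW hX.
have derivE w : ~ N w -> `|derive1 (fun y => X t y w) x| `^ p =
    expR (p * primitive (derive1 b \o flow X w x) t).
  move=> Nw; have [W0 cW cX XE] := N_good w Nw.
  have -> : (fun y => X t y w) = (fun y => flow X w y t).
    by apply/funext => y; rewrite /flow max_r.
  rewrite (flow_derivative (Cb1_is_derive hb) db_cont dbK cX XE)//.
  by rewrite ger0_norm ?expR_ge0// -expRM mulrC.
set a := 2 * p * M * Num.sqrt t * sup_norm b.
have a0 : 0 <= a by rewrite !mulr_ge0 ?sqrtr_ge0// ltW.
set c := (1 + 2 * p ^+ 2 * M ^+ 2) * T * sup_norm b ^+ 2.
have k0 : 0 <= 1 + 2 * p ^+ 2 * M ^+ 2.
  by rewrite addr_ge0// -mulrA mulr_ge0// mulr_ge0 ?sqr_ge0.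
have c0 : 0 <= c.
  by apply: mulr_ge0; [apply: mulr_ge0 => //; exact: ltW|exact: sqr_ge0].
(* Davie's bound and the mesh need t > 0; at t = 0 the derivative is 1. *)
have [t_eq0|t_neq0] := eqVneq t 0.
  apply: (@le_trans _ _ (\int[P]_w (1 : R))%:E).
    apply: (expectation_le_off_null mN PN0) => //.
      exact: bounded_measurable_cst.
    by move=> w /derivE ->; rewrite t_eq0 primitive0 mulr0 expR0.
  rewrite lee_fin Rintegral_probability_cst -[leLHS]mul1r.
  by apply: ler_pM => //; rewrite ?lerDl// -expR0 ler_expR.
have t_gt0 : 0 < t by rewrite lt_neqAle eq_sym t_neq0.
have [bY Y2] := girsanov_estimate hW hb mN PN0 N_good x p0 t_gt0.
have moment := brownian_exponential_moment hb mN PN0 N_good x hM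
  (mulr_ge0 (ler0n R 2) p0) t_gt0.
set Y := fun w => _ in bY.
have Y0 w : 0 <= Y w by rewrite mulr_ge0 ?expR_ge0// indicE.
apply: (@le_trans _ _ (\int[P]_w Y w)%:E).
  apply: (expectation_le_off_null mN PN0) => //.
  by move=> w Nw; rewrite derivE// /Y indicE mem_set// mul1r.
rewrite lee_fin -ler_sqr ?nnegrE ?mulr_ge0 ?expR_ge0 ?addr_ge0//; last first.
  exact: Rintegral_ge0.
apply: le_trans Y2 _.
have aE : 2 * p * (M * sup_norm b * Num.sqrt t) = a by rewrite /a; ring.
rewrite aE in moment.
apply: (@le_trans _ _ (expR (t * sup_norm b ^+ 2) * ((1 + a) * expR (a ^+ 2)))).
  by rewrite ler_wpM2l ?expR_ge0.
have a2 : a ^+ 2 = 4 * p ^+ 2 * M ^+ 2 * t * sup_norm b ^+ 2.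
  rewrite /a -[X in _ = _ * X * _](sqr_sqrtr t0); ring.
rewrite mulrCA -expRD [leRHS]exprMn -expRM_natl.
apply: ler_pM; rewrite ?addr_ge0 ?expR_ge0//.
  by rewrite expr2 ler_peMr ?addr_ge0// lerDl.
rewrite ler_expR a2 /c.
have q0 : 0 <= p ^+ 2 * M ^+ 2 by rewrite mulr_ge0 ?sqr_ge0.
have -> : t * sup_norm b ^+ 2 + 4 * p ^+ 2 * M ^+ 2 * t * sup_norm b ^+ 2 =
  t * sup_norm b ^+ 2 * (1 + 4 * (p ^+ 2 * M ^+ 2)) by ring.
have -> : 2 * ((1 + 2 * p ^+ 2 * M ^+ 2) * T * sup_norm b ^+ 2) =
  T * sup_norm b ^+ 2 * (2 + 4 * (p ^+ 2 * M ^+ 2)) by ring.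
apply: ler_pM.
- by rewrite mulr_ge0 ?sqr_ge0.
- by rewrite addr_ge0// mulr_ge0.
- by rewrite ler_wpM2r ?sqr_ge0.
- by rewrite lerD2r ler1n.
Qed.
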